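(* Let $k,s,t$ be integers with $k\ge 1$, $s\ge 0$, $t\ge 3$ and $k\ge s+2^{t-1}-t$. Suppose $G$ is a $k$-contraction-critical graph. If $S\subseteq V(G)$ satisfies $|S|\le s$ and $\alpha(G[S])\ge |S|-t$, then $G-S$ is connected.
   Context: Graphs are finite and simple. A graph $H$ is a minor of a graph $G$ if $H$ can be obtained from a subgraph of $G$ by contracting edges; it is a proper minor if it is a minor other than $G$ itself. A graph $G$ is $k$-contraction-critical if $G$ is $k$-chromatic (its chromatic number is exactly $k$) but every proper minor of $G$ is $(k-1)$-colorable. $G[S]$ is the subgraph induced by $S$, $G-S$ is the graph obtained by deleting the vertices of $S$, and $\alpha$ denotes the independence number. *)

(* Defs.v *)
From mathcomp Require Import all_boot.

Set Implicit Arguments.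
Unset Strict Implicit.
Unset Printing Implicit Defensive.

Record sgraph := SGraph {
  svertex :> finType;
  sedge : rel svertex;
  sedge_sym : symmetric sedge;
  sedge_irr : irreflexive sedge }.

Notation "x -- y" := (sedge x y) (at level 30).

Definition isomorphic (G H : sgraph) : Prop :=
  exists2 f : G -> H, bijective f & forall x y : G, (f x -- f y) = (x -- y).

(* H is (isomorphic to) a not necessarily induced subgraph of G. *)
Definition subgraph (H G : sgraph) : Prop :=
  exists2 f : H -> G, injective f & forall x y : H, x -- y -> f x -- f y.

Section Induced.
Variables (G : sgraph) (S : {set G}).

Definition induced_rel : rel {x : G | x \in S} := [rel a b | val a -- val b].

Fact induced_sym : symmetric induced_rel.
Proof. by move=> a b; apply: sedge_sym. Qed.

Fact induced_irr : irreflexive induced_rel.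
Proof. by move=> a; apply: sedge_irr. Qed.

Definition induced : sgraph := SGraph induced_sym induced_irr.
End Induced.

Definition del_vertices (G : sgraph) (S : {set G}) : sgraph := induced (~: S).

(* G / xy : y is removed and x stands for the merged vertex, so x inherits the
   neighbours of y. Only meaningful when x -- y. *)
Section Contract.
Variables (G : sgraph) (x y : G).

Definition contract_rel : rel {z : G | z != y} :=
  [rel a b | (a != b) &&
     [|| val a -- val b,
         (val a == x) && (y -- val b)
       | (val b == x) && (y -- val a)]].

Fact contract_sym : symmetric contract_rel.
Proof.
move=> a b; rewrite /contract_rel [in LHS]/rel_of_simpl /=.
by rewrite -!val_eqE /= eq_sym [val a -- val b]sedge_sym [X in _ || X]orbC.
Qed.

Fact contract_irr : irreflexive contract_rel.
Proof. by move=> a; rewrite /contract_rel /= eqxx. Qed.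

Definition contract : sgraph := SGraph contract_sym contract_irr.
End Contract.

(* [contracts G H]: up to isomorphism, H arises from G by contracting a
   (possibly empty) sequence of edges. *)
Inductive contracts : sgraph -> sgraph -> Prop :=
| contracts_iso (G H : sgraph) : isomorphic G H -> contracts G H
| contracts_edge (G H : sgraph) (x y : G) :
    x -- y -> contracts (contract x y) H -> contracts G H.

Definition minor (H G : sgraph) : Prop :=
  exists2 K : sgraph, subgraph K G & contracts K H.

(* Minors are taken up to isomorphism, so "other than G" means "not isomorphic
   to G". *)
Definition proper_minor (H G : sgraph) : Prop :=
  minor H G /\ ~ isomorphic H G.

Definition colorable (G : sgraph) (k : nat) : bool :=
  [exists f : {ffun G -> 'I_k}, forall x, forall y, (x -- y) ==> (f x != f y)].

Fact colorable_ex (G : sgraph) : exists k, colorable G k.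
Proof.
exists #|G|; apply/existsP; exists [ffun x => enum_rank x].
apply/forallP => x; apply/forallP => y; apply/implyP => xy; rewrite !ffunE.
by apply: contraTneq xy => /enum_rank_inj ->; rewrite sedge_irr.
Qed.

Definition chromatic_number (G : sgraph) : nat := ex_minn (colorable_ex G).

Definition contraction_critical (k : nat) (G : sgraph) : Prop :=
  chromatic_number G = k /\
  forall H : sgraph, proper_minor H G -> colorable H (k - 1).

Definition independent (G : sgraph) (A : {set G}) : bool :=
  [forall x in A, forall y in A, ~~ (x -- y)].

Definition independence_number (G : sgraph) : nat :=
  \max_(A : {set G} | independent A) #|A|.

Definition connected (G : sgraph) : Prop :=
  0 < #|G| /\ forall x y : G, connect (@sedge G) x y.

(* Main.v *)
Require Import Defs.
From mathcomp Require Import all_boot perm zify.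

Set Implicit Arguments.
Unset Strict Implicit.
Unset Printing Implicit Defensive.

(* Shrink S to a minimal separator of G, leaving a side X and a side Y; write K
   for k - 1 and split S into a nonempty independent set A and T with
   |T| <= t. Contracting A with a component of Y yields a K-colouring of
   G[X u S] in which A has a colour of its own. Such colourings of the two sides
   with all of T rainbow could be glued, so on one side, say X, none is rainbow.
   Take one with the most colours on T. By maximality each colour class of T
   lies in a single Kempe chain for every colour unused on S.

   Hence T has r < |T| colour classes, and 2^r - 1 colours besides |A| further
   ones are available. With that palette, G[X u S] contains disjoint connected
   pieces, one per class, such that every proper colouring of the minor formed by
   the pieces is realised on T by a recolouring of G[X u S], in which the colour
   of each class is absent from the pieces coloured otherwise. The induction on r
   pairs up all colours but one: the two-coloured components are contracted, the
   remaining r - 1 classes are treated in the quotient, and the last class, a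
   single vertex c, gets its chain in its own colour and one colour of each pair.
   If that chain misses a piece, a swap on the chain can give c the colour of the
   piece. The palette thus doubles (plus one) for each class.

   Contracting the pieces and the components of the rest of G[X u S] gives a
   K-colouring of a proper minor of G. On G[X u S] it is realised on S, by
   recolouring the pieces as above and exchanging colours in each remaining
   component. Gluing contradicts the chromatic number of G. *)

(** * Labelled pieces rooted at a rainbow set *)

Lemma connect_homo (U V : finType) (e : rel U) (e' : rel V) (h : U -> V) :
    (forall x y, e x y -> connect e' (h x) (h y)) ->
  forall x y, connect e x y -> connect e' (h x) (h y).
Proof.
move=> he x y /connectP[p]; elim: p x => [|z p IHp] x /=; first by move=> _ ->.
by case/andP=> /he xz zp yp; apply: connect_trans xz (IHp _ zp yp).
Qed.

Lemma connect_invariant (V : finType) (C : Type) (e : rel V) (h : V -> C) :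
    (forall x y, e x y -> h x = h y) ->
  forall x y, connect e x y -> h x = h y.
Proof.
move=> he x y /connectP[p]; elim: p x => [|z p IHp] x /=; first by move=> _ ->.
by case/andP=> /he-> zp yp; apply: IHp.
Qed.

Lemma connect_first (V : finType) (e : rel V) x y :
  connect e x y -> x = y \/ exists z, e x z.
Proof.
by case/connectP=> -[|z p] /=; [left | case/andP=> xz _ _; right; exists z].
Qed.

Lemma connect_last (V : finType) (e : rel V) x y :
  connect e x y -> y = x \/ exists z, e z y.
Proof.
case/connectP=> p; elim/last_ind: p => [|p z _] /=; first by left.
by rewrite rcons_path last_rcons => /andP[_ zy] ->; right; exists (last x p).
Qed.

Definition within (V : finType) (C : eqType) (e : rel V) (l : V -> C) (c : C) :
  rel V := [rel x y | [&& e x y, l x == c & l y == c]].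

Definition transpose (a b x : nat) := if x == a then b else if x == b then a else x.

Lemma transpose_inj a b : injective (transpose a b).
Proof. move=> x y; rewrite /transpose; do ![case: eqP => //]; congruence. Qed.

(* Colours of roots 0, ..., r, chosen so that halving a colour of an earlier root
   gives its colour in the quotient; all are even and the last is 2^(r+1) - 2. *)
Definition root_color (r i : nat) := 2 ^ r.+1 - 2 ^ (r.+1 - i).

Lemma root_colorS r i : i <= r -> root_color r.+1 i = (root_color r i).*2.
Proof.
move=> ir; rewrite /root_color (@subSn i r.+1 (leqW ir)).
by rewrite (expnS 2 r.+1) (expnS 2 (r.+1 - i)) -mulnBr mul2n.
Qed.

Lemma root_color_last r : root_color r r = (2 ^ r - 1).*2.
Proof. by rewrite /root_color subSnn expn1 expnS -mul2n mulnBr muln1. Qed.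

Lemma root_color_lt r i : i <= r -> root_color r i < (2 ^ r.+1 - 1).
Proof.
move=> ir; have := leq_pexp2l (isT : 0 < 2) (leq_subr i r.+1).
have := @leq_pexp2l 2 1 (r.+1 - i) isT; rewrite subn_gt0 ltnS ir expn1.
by move=> /(_ isT); rewrite /root_color; lia.
Qed.

Lemma root_color_inj r i j :
  i <= r -> j <= r -> root_color r i = root_color r j -> i = j.
Proof.
move=> ir jr; have := leq_pexp2l (isT : 0 < 2) (leq_subr i r.+1).
have := leq_pexp2l (isT : 0 < 2) (leq_subr j r.+1); rewrite /root_color => h1 h2 h.
have /eqP: 2 ^ (r.+1 - i) = 2 ^ (r.+1 - j) by lia.
by rewrite eqn_exp2l // => /eqP; lia.
Qed.

Lemma root_color_odd r i : i <= r -> odd (root_color r i) = false.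
Proof.
move=> ir; rewrite /root_color (@subSn i r ir).
by rewrite (expnS 2 r) (expnS 2 (r - i)) -mulnBr mul2n odd_double.
Qed.

(** Colours [2j] and [2j+1] form a pair. For a proper [phi] the components are the Kempe chains of
    the pairs. *)
Definition pair_rel (V : finType) (e : rel V) (phi : V -> nat) : rel V :=
  [rel x y | e x y && ((phi x)./2 == (phi y)./2)].

(* [psi] colours the pieces, i.e. the label classes [0, ..., r]; [phi'] realises
   its pattern on the roots [d i], whose colours do not occur on the pieces that
   [psi] colours differently. *)
Definition lifting (V : finType) (r : nat) (e : rel V) (phi : V -> nat)
    (d : nat -> V) (lab : V -> nat) (psi : nat -> nat) (phi' : V -> nat) :=
  [/\ forall x y, e x y -> phi' x != phi' y,
      forall x, phi' x < 2 ^ r.+1 - 1,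
      forall i j, i <= r -> j <= r -> psi i = psi j -> phi' (d i) = phi' (d j),
      forall i v, i <= r -> lab v <= r -> psi (lab v) <> psi i ->
        phi' v != phi' (d i) &
      forall i v, i <= r -> phi v = phi (d i) ->
        connect (pair_rel e phi) (d i) v -> phi' v = phi' (d i)].

(** Labels above [r] mark vertices in no piece. The third clause will put each vertex of [T] into
    the piece of the root of its colour class. *)
Definition rooted_pieces (V : finType) (r : nat) (e : rel V) (phi : V -> nat)
    (d : nat -> V) (lab : V -> nat) :=
  [/\ forall i, i <= r -> lab (d i) = i,
      forall v, lab v <= r -> connect (within e lab (lab v)) (d (lab v)) v,
      forall i v, i <= r -> phi v = phi (d i) ->
        connect (pair_rel e phi) (d i) v -> lab v = i &
      forall psi : nat -> nat,
        (forall x y, e x y -> lab x <= r -> lab y <= r -> lab x != lab y ->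
           psi (lab x) <> psi (lab y)) ->
        exists phi', lifting r e phi d lab psi phi'].

(** * Adding one root: lifting pieces from the quotient *)

Section Step.

Variables (V : finType) (r : nat) (e : rel V) (phi : V -> nat) (d : nat -> V).
Let N := 2 ^ r.+1 - 1.
Hypothesis e_sym : symmetric e.
Hypothesis phi_proper : forall x y, e x y -> phi x != phi y.
Hypothesis phi_lt : forall x, phi x < N.*2.+1.
Hypothesis phi_d : forall i, i <= r.+1 -> phi (d i) = root_color r.+1 i.

Let rt := root (pair_rel e phi).

(* The components of [pair_rel] are contracted onto their canonical
   representatives; every other vertex, and every vertex of the last colour
   [N.*2], is left isolated. *)
Definition merged_rel : rel V :=
  [rel x y | (x != y) && [exists u, exists v,
     [&& e u v, (phi u)./2 < N, (phi v)./2 < N, rt u == x & rt v == y]]].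

(** The value 0 is a dummy for vertices of the last colour, which are isolated in [merged_rel]. *)
Definition merged_color x := if (phi x)./2 < N then (phi x)./2 else 0.

Let N_gt0 : 0 < N.
Proof. by rewrite /N subn_gt0 -(expn0 2) ltn_exp2l. Qed.

Let pair_sym : connect_sym (pair_rel e phi).
Proof.
by apply: sym_connect_sym => x y; rewrite /pair_rel /= e_sym [_ == (phi x)./2]eq_sym.
Qed.

Let rtP x y : reflect (rt x = rt y) (connect (pair_rel e phi) x y).
Proof. exact: (rootP pair_sym). Qed.

Let half_rt x : (phi (rt x))./2 = (phi x)./2.
Proof.
apply/esym/(connect_invariant (e := pair_rel e phi) (h := fun x => (phi x)./2)).
  by move=> u v /andP[_ /eqP].
exact: connect_root.
Qed.

Let rtK x : rt (rt x) = rt x.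
Proof. exact: (root_root pair_sym). Qed.

Lemma merged_sym : symmetric merged_rel.
Proof.
suff h x y : merged_rel x y -> merged_rel y x by move=> x y; apply/idP/idP; apply: h.
case/andP=> xy /existsP[u /existsP[v /and5P[uv u_lt v_lt ux vy]]].
rewrite /merged_rel /= eq_sym xy; apply/existsP; exists v; apply/existsP; exists u.
by rewrite e_sym; apply/and5P.
Qed.

Lemma merged_proper x y : merged_rel x y -> merged_color x != merged_color y.
Proof.
case/andP=> xy /existsP[u /existsP[v /and5P[uv u_lt v_lt /eqP ux /eqP vy]]].
rewrite /merged_color -ux -vy !half_rt u_lt v_lt; apply: contra xy => uv2.
by rewrite -ux -vy; apply/eqP/rtP/connect1; rewrite /pair_rel /= uv.
Qed.

Lemma merged_lt x : merged_color x < N.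
Proof. by rewrite /merged_color; case: ifP. Qed.

Let half_d i : i <= r -> (phi (d i))./2 = root_color r i.
Proof. by move=> ir; rewrite phi_d ?leqW // root_colorS // doubleK. Qed.

Lemma merged_d i : i <= r -> merged_color (rt (d i)) = root_color r i.
Proof. by move=> ir; rewrite /merged_color half_rt half_d // root_color_lt. Qed.

Variable lab0 : V -> nat.
Hypothesis lab0P : rooted_pieces r merged_rel merged_color (fun i => rt (d i)) lab0.

Let lab0_d : forall i, i <= r -> lab0 (rt (d i)) = i.
Proof. by case: lab0P. Qed.

Let lab0_conn v : lab0 v <= r ->
  connect (within merged_rel lab0 (lab0 v)) (rt (d (lab0 v))) v.
Proof. by case: lab0P => _ h _ _; apply: h. Qed.

(* The piece of the new root uses only even colours, so that odd colours stay
   private to the roots of the other pieces. *)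
Let ok v := ~~ odd (phi v) && (r < lab0 (rt v)).
Let new_rel : rel V := [rel x y | [&& e x y, ok x & ok y]].
Let E v := connect new_rel (d r.+1) v.
Definition step_label v :=
  if lab0 (rt v) <= r then lab0 (rt v) else if E v then r.+1 else r.+2.
Let lab := step_label.

(** An old piece is reached from its root along merged edges, and these avoid the last colour
    [N.*2], as do the old roots. *)
Let lab0_low v : lab0 (rt v) <= r -> (phi v)./2 < N.
Proof.
move=> v_lab; rewrite -half_rt; have [->|[z]] := connect_last (lab0_conn v_lab).
  by rewrite half_rt half_d // root_color_lt.
case/and3P=> /andP[_ /existsP[u /existsP[x /and5P[_ _ x_lt _ /eqP <-]]]] _ _.
by rewrite half_rt.
Qed.

Let phi_c : phi (d r.+1) = N.*2.
Proof. by rewrite phi_d // root_color_last. Qed.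

Let ok_c : ok (d r.+1).
Proof.
rewrite /ok phi_c odd_double ltnNge /=; apply/negP => /lab0_low.
by rewrite phi_c doubleK ltnn.
Qed.

Let E_ok v : E v -> ok v.
Proof. by case/connect_last=> [->|[z /and3P[]]]; first exact: ok_c. Qed.

Let E_lab0 v : E v -> r < lab0 (rt v).
Proof. by case/E_ok/andP. Qed.

Let E_nbr x y : E x -> e x y -> ok y -> E y.
Proof.
move=> Ex xy oky; apply: (connect_trans Ex (connect1 _)).
by rewrite /new_rel /= xy (E_ok Ex).
Qed.

Let lab_old v : lab v <= r -> lab0 (rt v) = lab v.
Proof. by rewrite /lab /step_label; do ![case: ifP => //] => _ _; lia. Qed.

Let lab_new v : (lab v == r.+1) = E v.
Proof.
rewrite /lab /step_label; case: leqP => [h|h].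
  by apply/idP/idP => [/eqP|/E_lab0]; lia.
by case: (E v); rewrite ?eqxx // gtn_eqF.
Qed.

Let lab_dE i : i <= r -> lab (d i) = i.
Proof. by move=> ir; rewrite /lab /step_label lab0_d // ir. Qed.

Let lab_d i : i <= r.+1 -> lab (d i) = i.
Proof.
rewrite leq_eqVlt => /orP[/eqP->|]; last exact: lab_dE.
by apply/eqP; rewrite lab_new; apply: connect0.
Qed.

Let conn_fiber c u v : c <= r -> lab0 (rt u) = c -> rt u = rt v ->
  connect (within e lab c) u v.
Proof.
move=> cr uc /rtP/connectP[p]; elim: p u uc => [|z p IHp] u uc /=.
  by move=> _ ->.
case/andP=> uz zp vE; have rtz : rt u = rt z by apply/rtP/connect1.
apply: connect_trans (IHp z _ zp vE); last by rewrite -rtz.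
apply: connect1; case/andP: uz => uz _.
by rewrite /within /= uz /lab /step_label -rtz uc cr eqxx.
Qed.

Let lab_conn v : lab v <= r.+1 -> connect (within e lab (lab v)) (d (lab v)) v.
Proof.
rewrite leq_eqVlt ltnS => /orP[/eqP lv|lv].
  rewrite lv; have : E v by rewrite -lab_new lv.
  rewrite /E; have : E (d r.+1) by apply: connect0.
  move: (d r.+1) => u Eu /connectP[p]; elim: p u Eu => [|z p IHp] u Eu /=.
    by move=> _ ->.
  case/andP=> /and3P[uz _ okz] zp vE; have Ez := E_nbr Eu uz okz.
  apply: connect_trans (IHp z Ez zp vE); apply: connect1.
  by rewrite /within /= uz !lab_new Eu.
have l0 := lab_old lv; set c := lab v in lv l0 *.
(* A path of the quotient lifts edge by edge: each merged edge comes from an edge [a], [b] of [e],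
   and [conn_fiber] bridges the fibres between. *)
have key x y : connect (within merged_rel lab0 c) x y -> lab0 x = c -> rt x = x ->
    forall u w, rt u = x -> rt w = y -> connect (within e lab c) u w.
  case/connectP=> p; elim: p x => [|z p IHp] x /=.
    by move=> _ -> xc _ u w ux wx; apply: conn_fiber; rewrite ?ux.
  case/andP=> /and3P[/andP[_ /existsP[a /existsP[b /and5P[ab _ _ /eqP ax /eqP bz]]]]].
  move=> _ /eqP zc zp yE xc _ u w ux wy.
  apply: (@connect_trans _ _ a); first by apply: conn_fiber; rewrite ?ux ?ax.
  apply: (@connect_trans _ _ b); last by apply: (IHp z); rewrite // -bz rtK.
  by apply: connect1; rewrite /within /= ab /lab /step_label ax bz xc zc lv eqxx.
have := @lab0_conn (rt v); rewrite l0 => /(_ lv) h.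
by apply: (key _ _ h); rewrite ?lab0_d ?rtK.
Qed.

(** The last colour [N.*2] has no partner in the palette, so the component of [d r.+1] is a single
    vertex. *)
Let class_rt i v : i <= r.+1 -> phi v = phi (d i) ->
  connect (pair_rel e phi) (d i) v -> rt v = rt (d i) /\ (i = r.+1 -> v = d i).
Proof.
move=> ir vi c; split; first by apply/esym/rtP.
move=> ir1; case: (connect_first c) => // -[z /andP[cz]].
rewrite ir1 phi_c doubleK => /eqP h; have := phi_proper cz; have := phi_lt z.
rewrite ir1 phi_c; have := odd_double_half (phi z); rewrite -h; case: odd; lia.
Qed.

Let lab_class i v : i <= r.+1 -> phi v = phi (d i) ->
  connect (pair_rel e phi) (d i) v -> lab v = i.
Proof.
move=> ir vi c; have [h1 h2] := class_rt ir vi c.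
move: ir; rewrite leq_eqVlt => /orP[/eqP ir|ir].
  by rewrite h2 // lab_d // ir.
by rewrite /lab /step_label h1 lab0_d -ltnS // ir.
Qed.

Section Lift.

Variable psi : nat -> nat.
Hypothesis psi_proper : forall x y, e x y -> lab x <= r.+1 -> lab y <= r.+1 ->
  lab x != lab y -> psi (lab x) <> psi (lab y).
Variable phi0 : V -> nat.
Hypothesis phi0P :
  lifting r merged_rel merged_color (fun i => rt (d i)) lab0 psi phi0.

Let phi0_lt v : phi0 v < N. Proof. by case: phi0P. Qed.

(* Within a piece the two colours of each pair are exchanged unless the piece is
   to share its colour with the new root. *)
Let flip v := (lab0 (rt v) <= r) && (psi (lab0 (rt v)) != psi r.+1).
Let phi1 v := if (phi v)./2 < N then (phi0 (rt v)).*2 + (odd (phi v) (+) flip v)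
              else N.*2.

(** Adjacent vertices of one pair component have opposite parities and are flipped together;
    distinct components are separated by [phi0], and [N.*2] exceeds all other values. *)
Let phi1_proper x y : e x y -> phi1 x != phi1 y.
Proof.
move=> xy; have := phi_proper xy; have := phi_lt x; have := phi_lt y.
have := odd_double_half (phi x); have := odd_double_half (phi y).
have := phi0_lt (rt x); have := phi0_lt (rt y).
rewrite /phi1; case: (ltnP (phi x)./2 N) => hx; case: (ltnP (phi y)./2 N) => hy; last first.
- by case: (odd (phi x)); case: (odd (phi y)) => /=; lia.
- by case: (odd (phi x)); case: (odd (phi y)) => /=; case: flip; lia.
- by case: (odd (phi x)); case: (odd (phi y)) => /=; case: flip; lia.
case: (eqVneq (rt x) (rt y)) => rxy.
  rewrite /flip rxy; have: (phi x)./2 = (phi y)./2 by rewrite -half_rt rxy half_rt.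
  by move=> ->; case: (odd (phi x)); case: (odd (phi y)) => /=; case: (_ && _) => /=; lia.
have: phi0 (rt x) != phi0 (rt y).
  case: phi0P => h _ _ _ _; apply: h; rewrite /merged_rel /= rxy; apply/existsP; exists x.
  by apply/existsP; exists y; apply/and5P.
by case: (odd (phi x)); case: (odd (phi y)) => /=; case: (flip x); case: (flip y); lia.
Qed.

(* The colour of the new root is [s.*2]: [N.*2] itself, or the colour of the
   roots with the same [psi]-value. *)
Let target : {s | [/\ s <= N,
  forall i, i <= r -> psi i = psi r.+1 -> phi0 (rt (d i)) = s &
  forall v, lab0 v <= r -> psi (lab0 v) <> psi r.+1 -> phi0 v != s]}.
Proof.
case: phi0P => _ _ h3 h4 _.
case: (pickP (fun j : 'I_r.+1 => psi j == psi r.+1)) => [j /eqP jr|none].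
  have j_le : j <= r by rewrite -ltnS.
  exists (phi0 (rt (d j))); split.
  - exact: ltnW.
  - by move=> i ir ij; apply: h3; rewrite // ij.
  - by move=> v vr vj; apply: h4; rewrite // jr.
exists N; split => // [i ir ij|v _ _]; last by rewrite ltn_eqF.
by have := none (Ordinal (ir : i < r.+1)); rewrite ij eqxx.
Qed.

Lemma lifting_step : exists phi', lifting r.+1 e phi d lab psi phi'.
Proof.
have [s [sN s_eq s_neq]] := target; case: phi0P => _ _ h3 h4 _.
pose phi2 v := if E v then transpose N.*2 s.*2 (phi1 v) else phi1 v.
have phi1_lt v : phi1 v < N.*2.+1.
  by rewrite /phi1; case: ifP => // _; have := phi0_lt (rt v); case: (_ (+) _); lia.
have old_phi2 v : lab0 (rt v) <= r -> phi2 v = phi1 v.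
  by rewrite /phi2; case: ifP => // /E_lab0; lia.
(* An old root becomes odd exactly when [psi] separates it from the new root; the chain [E], whose
   colours stay even, then avoids its colour. *)
have phi1_d i : i <= r -> phi1 (d i) = (phi0 (rt (d i))).*2 + (psi i != psi r.+1).
  move=> ir; rewrite /phi1 half_d // root_color_lt // /flip lab0_d // ir.
  by rewrite phi_d ?leqW // root_color_odd // leqW.
have phi2_d i : i <= r -> phi2 (d i) = phi1 (d i).
  by move=> ir; rewrite old_phi2 // lab0_d.
have phi2_c : phi2 (d r.+1) = s.*2.
  have -> : phi2 (d r.+1) = transpose N.*2 s.*2 (phi1 (d r.+1)).
    by rewrite /phi2 /E connect0.
  by rewrite /phi1 phi_c doubleK ltnn /transpose eqxx.
have phi1_E v : E v -> ~~ odd (phi1 v).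
  move=> Ev; case/andP: (E_ok Ev) => v_even v_lab.
  rewrite /phi1; case: ifP => _; last by rewrite odd_double.
  by rewrite /flip leqNgt v_lab (negbTE v_even) addn0 odd_double.
(* A neighbour [y] outside the chain is odd or lies in an old piece. If it had colour [s.*2] with
   [s < N], it would lie in an old piece with the [psi]-value of the new root, against [psi_proper].
   If it had colour [N.*2], it would be even and in no old piece, hence in the chain. *)
have boundary x y : E x -> ~~ E y -> e x y -> phi2 x != phi2 y.
  move=> Ex Ey xy; have oky : ~~ ok y by apply: contra Ey; apply: E_nbr Ex xy.
  rewrite /phi2 Ex (negbTE Ey) /transpose; have xy1 := phi1_proper xy.
  case: (phi1 x =P N.*2) => [xN|_].
    rewrite xN in xy1; apply/eqP => sy; move: sy xy1; rewrite {1 2}/phi1.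
    case: ifP => [y_lt|_ _]; last by rewrite eqxx.
    move=> sy _; have {sy}: phi0 (rt y) = s /\ odd (phi y) (+) flip y = false.
      by move: sy; case: (_ (+) _) => /=; lia.
    case=> sy; case: (leqP (lab0 (rt y)) r) => y_lab.
      case: (eqVneq (psi (lab0 (rt y))) (psi r.+1)) => [yr _|/eqP yr].
        have ly : lab y = lab0 (rt y) by rewrite /lab /step_label y_lab.
        have lx : lab x = r.+1 by apply/eqP; rewrite lab_new.
        have /psi_proper[//|||] := xy; rewrite ?lx ?ly ?leqnn ?leqW //.
        by rewrite gtn_eqF.
      by have := s_neq _ y_lab yr; rewrite sy eqxx.
    rewrite /flip leqNgt y_lab addbF => y_even.
    by rewrite /ok y_even y_lab in oky.
  case: (phi1 x =P s.*2) => [_|//]; apply/eqP => yN; move: oky.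
  have: (phi y)./2 >= N.
    rewrite leqNgt; apply/negP => y_lt; move: yN; rewrite /phi1 y_lt.
    by have := phi0_lt (rt y); case: (_ (+) _); lia.
  move=> y_ge; rewrite /ok ltnNge; case: (leqP (lab0 _)) => [/lab0_low|_]; first lia.
  rewrite andbT negbK; have := odd_double_half (phi y); have := phi_lt y.
  by case: odd => //; lia.
exists phi2; split.
- move=> x y xy; case Ex: (E x); case Ey: (E y).
  + rewrite /phi2 Ex Ey; apply: contra (phi1_proper xy) => /eqP h.
    by apply/eqP; apply: transpose_inj h.
  + by apply: boundary; rewrite ?Ey.
  + by rewrite eq_sym; apply: boundary; rewrite ?Ex // e_sym.
  + by rewrite /phi2 Ex Ey phi1_proper.
- move=> x; have : 2 ^ r.+2 - 1 = N.*2.+1.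
    by rewrite /N (expnS 2 r.+1); move: N_gt0; rewrite /N; lia.
  move=> ->; rewrite /phi2 /transpose; have := phi1_lt x.
  by do ![case: ifP => _]; lia.
- have half i : i <= r -> psi i = psi r.+1 -> phi2 (d i) = phi2 (d r.+1).
    by move=> ir ic; rewrite phi2_c phi2_d // phi1_d // ic eqxx addn0 s_eq.
  move=> i j; rewrite leq_eqVlt ltnS => /orP[/eqP->|ir].
    by rewrite leq_eqVlt ltnS => /orP[/eqP->|jr] // h; rewrite half.
  rewrite leq_eqVlt ltnS => /orP[/eqP->|jr] h; first by rewrite half.
  by rewrite !phi2_d // !phi1_d // h (h3 i j).
- move=> i v ir vr iv; move: ir vr iv.
  rewrite leq_eqVlt ltnS => /orP[/eqP->|ir].
    rewrite phi2_c leq_eqVlt ltnS => /orP[/eqP-> //|vr].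
    have l0 := lab_old vr; rewrite -l0 => /s_neq; rewrite l0 => /(_ vr).
    rewrite old_phi2 ?l0 // /phi1 lab0_low ?l0 //.
    by case: (_ (+) _); lia.
  rewrite leq_eqVlt ltnS => /orP[/eqP vr|vr].
    rewrite vr phi2_d // phi1_d // => /eqP; rewrite eq_sym => ->.
    have Ev : E v by rewrite -lab_new vr.
    have : ~~ odd (phi2 v).
      by rewrite /phi2 Ev /transpose; do ![case: ifP => _]; rewrite ?odd_double ?phi1_E.
    by apply: contra => /eqP->; rewrite addn1 /= odd_double.
  have l0 := lab_old vr; rewrite -l0 phi2_d // phi1_d // old_phi2 ?l0 //.
  rewrite -{1}l0 => /h4; rewrite l0 => /(_ ir vr).
  rewrite /phi1 lab0_low ?l0 //; case: (psi i != psi r.+1); case: (_ (+) _) => /=; lia.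
- move=> i v ir vi c; have [h1 h2] := class_rt ir vi c.
  move: ir; rewrite leq_eqVlt => /orP[/eqP/h2-> //|]; rewrite ltnS => ir.
  rewrite phi2_d // old_phi2 ?h1 ?lab0_d //.
  by rewrite /phi1 /flip vi h1.
Qed.

End Lift.

Lemma rooted_pieces_step : rooted_pieces r.+1 e phi d lab.
Proof.
split; [exact: lab_d | exact: lab_conn | exact: lab_class | move=> psi psi_proper].
case: (lab0P) => _ _ _ /(_ psi)[|phi0 phi0P]; last exact: (lifting_step psi_proper phi0P).
move=> x y /andP[_ /existsP[u /existsP[v /and5P[uv _ _ /eqP <- /eqP <-]]]] ur vr uv_lab.
have lu : lab u = lab0 (rt u) by rewrite /lab /step_label ur.
have lv : lab v = lab0 (rt v) by rewrite /lab /step_label vr.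
by have := psi_proper u v uv; rewrite lu lv; apply=> //; apply: leqW.
Qed.

End Step.

Lemma rooted_pieces_exist r (V : finType) (e : rel V) (phi : V -> nat)
    (d : nat -> V) :
    symmetric e -> (forall x y, e x y -> phi x != phi y) ->
    (forall x, phi x < 2 ^ r.+1 - 1) ->
    (forall i, i <= r -> phi (d i) = root_color r i) ->
  exists lab, rooted_pieces r e phi d lab.
Proof.
elim: r e phi d => [|r IHr] e phi d e_sym proper lt_phi phi_d.
  (* For [r = 0] the palette is a single colour, so there are no edges and [d 0] alone is the
     piece. *)
  have no_e x y : e x y = false.
    by apply/negP => /proper; have := lt_phi x; have := lt_phi y; lia.
  have no_conn (e' : rel V) : subrel e' e -> forall x y, connect e' x y -> x = y.
    by move=> sub x y /connect_first[//|[z /sub]]; rewrite no_e.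
  exists (fun v => (v != d 0) : nat); split.
  - by case=> // _; rewrite eqxx.
  - by move=> v; case: eqP => // ->; rewrite connect0.
  - by case=> // v _ _ /no_conn-> => [|x y /andP[]//]; rewrite eqxx.
  move=> psi _; exists phi; split => //.
  - by case=> // -[].
  - by case=> // v _; case: eqP.
have lt_phi' x : phi x < (2 ^ r.+1 - 1).*2.+1.
  by have := lt_phi x; rewrite (expnS 2 r.+1); lia.
have [|||i ir|lab0 lab0P] := IHr (merged_rel r e phi) (merged_color r phi)
  (fun i => root (pair_rel e phi) (d i)).
- exact: merged_sym.
- exact: merged_proper.
- exact: merged_lt.
- exact: merged_d.
by exists (step_label r e phi d lab0); apply: rooted_pieces_step.
Qed.

(** * Contractions and colourings *)

(** The permutation is built along the list: each new element costs one transposition, which fixes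
    the values already matched. *)
Lemma match_colors (I : eqType) (K : finType) (l : seq I) (g f : I -> K) :
    {in l &, forall x y, (g x == g y) = (f x == f y)} ->
  exists s : {perm K}, {in l, forall x, s (g x) = f x}.
Proof.
elim: l => [|x l IHl] gf; first by exists 1%g.
have [|s sP] := IHl.
  by move=> y z yl zl; apply: gf; rewrite inE ?yl ?zl orbT.
exists (s * tperm (s (g x)) (f x))%g => y; rewrite inE permM.
have [->|yx /= yl] := eqVneq; first by rewrite tpermL.
have := gf x y; rewrite !inE eqxx yl orbT => /(_ isT isT).
rewrite -(sP y yl); case: (eqVneq (g x) (g y)) => [->|gxy].
  by move=> /esym/eqP ->; rewrite tpermL.
move=> /esym/negbT fsy; rewrite tpermD // (inj_eq perm_inj) //.
Qed.

Definition class_connected (G : sgraph) (L : eqType) (l : G -> L) :=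
  forall x y : G, l x = l y -> connect (within (@sedge G) l (l x)) x y.

(** An edge inside a class is contracted, which keeps the classes connected, and induction on the
    number of vertices applies. Once no such edge is left, connectedness makes every class a single
    vertex. *)
Lemma contract_classes (G : sgraph) (L : eqType) (l : G -> L) :
    class_connected l ->
  exists (M : sgraph) (p : G -> M),
    [/\ contracts G M, #|M| <= #|G|,
        forall x y, l x = l y -> p x = p y,
        forall x y, x -- y -> l x <> l y -> p x -- p y &
        forall x y, x <> y -> l x = l y -> #|M| < #|G| ].
Proof.
have [n] := ubnP #|G|; elim: n => // n IHn in G l * => G_lt conn.
case: (pickP (fun uv : G * G => (uv.1 -- uv.2) && (l uv.1 == l uv.2))) => [|no_edge].
  case=> u v /= /andP[uv /eqP luv].
  have u_neq : u != v by apply: contraTneq uv => ->; rewrite sedge_irr.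
  pose h (z : G) : {z : G | z != v} := insubd (Sub u u_neq) z.
  have hE z : val (h z) = if z == v then u else z.
    by rewrite val_insubd; case: eqP.
  have lh z : l (val (h z)) = l z by rewrite hE; case: eqP => // ->.
  have h_edge x y : x -- y -> h x <> h y -> contract_rel u (h x) (h y).
    move=> xy /eqP hxy; rewrite /contract_rel /= hxy !hE.
    case: (eqVneq x v) => [xv|_]; case: (eqVneq y v) => [yv|_].
    + by rewrite xv yv sedge_irr in xy.
    + by rewrite eqxx -xv xy /= orbT.
    + by rewrite eqxx -yv (sedge_sym y x) xy !orbT.
    + by rewrite xy.
  have card_lt : #|contract u v| < #|G|.
    by rewrite card_sig (cardC1 v) prednK //; apply/card_gt0P; exists v.
  have [||M [p [GM M_le p_eq p_edge _]]] :=
    @IHn (contract u v) (fun z => l (val z)).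
  + exact: leq_trans card_lt G_lt.
  + move=> a b /= lab.
    have hK (z : {z : G | z != v}) : h (val z) = z.
      by apply: val_inj; rewrite hE (negbTE (valP z)).
    rewrite -(hK a) -(hK b); apply: connect_homo (conn _ _ lab) => x y.
    case/and3P=> xy /eqP lx /eqP ly.
    case: (eqVneq (h x) (h y)) => [->|/eqP hxy]; first exact: connect0.
    by apply: connect1; rewrite /within /= !lh lx ly eqxx andbT h_edge.
  exists M, (fun z => p (h z)); split.
  + exact: contracts_edge uv GM.
  + exact: leq_trans M_le (ltnW card_lt).
  + by move=> x y lxy; apply: p_eq; rewrite !lh.
  + move=> x y xy lxy; apply: p_edge; rewrite ?lh //.
    by apply: h_edge => // hxy; apply: lxy; rewrite -(lh x) hxy lh.
  + by move=> _ _ _ _; apply: leq_ltn_trans M_le card_lt.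
exists G, id; split=> //.
+ by apply: contracts_iso; exists id => //; exists id.
+ move=> x y /conn/connect_first[//|[z /and3P[xz _ lz]]].
  by have := no_edge (x, z); rewrite /= xz eq_sym lz.
+ move=> x y xy /conn/connect_first[//|[z /and3P[xz _ lz]]].
  by have := no_edge (x, z); rewrite /= xz eq_sym lz.
Qed.

Lemma proper_minor_card (G H : sgraph) : minor H G -> #|H| < #|G| -> proper_minor H G.
Proof.
move=> HG H_lt; split=> // -[f f_bij _].
by move: H_lt; rewrite (bij_eq_card f_bij) ltnn.
Qed.

Section Critical.

Variables (k : nat) (G : sgraph).
Hypothesis Gcrit : contraction_critical k G.

Lemma minor_coloring (H : sgraph) : minor H G -> #|H| < #|G| ->
  exists f : H -> 'I_(k - 1), forall x y, x -- y -> f x != f y.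
Proof.
move=> HG /(proper_minor_card HG) /(proj2 Gcrit) /existsP[f /forallP fP].
by exists f => x y; have /forallP/(_ y)/implyP := fP x.
Qed.

(** A repeated label makes the quotient a smaller, hence proper, minor; its colouring is pulled back
    to [G]. *)
Lemma quotient_coloring (L : eqType) (l : G -> L) : class_connected l ->
    (exists x y, x <> y /\ l x = l y) ->
  exists f : G -> 'I_(k - 1),
    (forall x y, l x = l y -> f x = f y) /\
    (forall x y, x -- y -> l x <> l y -> f x <> f y).
Proof.
move=> /contract_classes[M [p [GM _ p_eq p_edge M_lt]]] [x [y [xy lxy]]].
have GG : subgraph G G by exists id.
have [//||f fP] := @minor_coloring M; first by exists G.
  exact: M_lt xy lxy.
exists (fun z => f (p z)); split => [u v /p_eq-> //|u v uv luv].
by apply/eqP/fP/p_edge.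
Qed.

Lemma subset_coloring (W : {set G}) z : z \in W -> W != setT ->
  exists f : G -> 'I_(k - 1), {in W &, forall x y, x -- y -> f x != f y}.
Proof.
move=> zW W_neq; pose H := induced W.
have HG : subgraph H G by exists val => //; apply: val_inj.
have [||f fP] := @minor_coloring H.
- by exists H => //; apply: contracts_iso; exists id => //; exists id.
- rewrite card_sig; move: W_neq; rewrite -properT => /proper_card.
  by rewrite cardsT; apply: leq_trans; rewrite ltnS subset_leq_card //; apply/subsetP.
(* [z] serves as the default value of [insubd] outside [W]. *)
exists (fun x => f (insubd (Sub z zW : {x | x \in W}) x)) => x y xW yW xy.
by apply: fP; rewrite /= /induced_rel /= !insubdK.
Qed.

Lemma crit_no_coloring (f : G -> 'I_(k - 1)) : 0 < k ->
  ~ (forall x y, x -- y -> f x != f y).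
Proof.
move=> k_gt0 fP; case: Gcrit; rewrite /chromatic_number.
case: ex_minnP => m _ min_m mk _; have := min_m (k - 1); rewrite mk.
suff -> : colorable G (k - 1) by move=> /(_ isT); lia.
apply/existsP; exists (finfun f); apply/forallP => x; apply/forallP => y.
by apply/implyP => /fP; rewrite !ffunE.
Qed.

(* The two colourings are made to agree on the common part by permuting colours. *)
Lemma no_matching_colorings (P Q : {set G}) (f g : G -> 'I_(k - 1)) : 0 < k ->
    (forall x, (x \in P) || (x \in Q)) ->
    (forall x y, x -- y -> (x \in P) && (y \in P) || (x \in Q) && (y \in Q)) ->
    {in P &, forall x y, x -- y -> f x != f y} ->
    {in Q &, forall x y, x -- y -> g x != g y} ->
  ~ {in P :&: Q &, forall x y, (f x == f y) = (g x == g y)}.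
Proof.
move=> k_gt0 PQ edges fP gQ fg.
have [|s sP] := @match_colors _ _ (enum (P :&: Q)) f g.
  by move=> x y; rewrite !mem_enum; apply: fg.
pose h x := if x \in Q then g x else s (f x).
have hP x : x \in P -> h x = s (f x).
  by move=> xP; rewrite /h; case: ifP => // xQ; rewrite sP // mem_enum inE xP.
apply: (@crit_no_coloring h) => // x y xy.
case/orP: (edges x y xy) => /andP[xPQ yPQ].
  by rewrite !hP // (inj_eq perm_inj) fP.
by rewrite /h xPQ yPQ gQ.
Qed.

End Critical.

(** * The two sides of a separator *)

Lemma connect_within (V : finType) (C : eqType) (e e' : rel V) (l : V -> C) :
    (forall x y, e x y -> e' x y /\ l x = l y) ->
  forall x y, connect e x y -> connect (within e' l (l x)) x y.
Proof.
move=> ee' x y /connectP[p]; elim: p x => [|z p IHp] x /=; first by move=> _ ->.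
case/andP=> /ee'[xz lxz] zp yp; apply: (@connect_trans _ _ z); last first.
  by rewrite lxz; apply: IHp.
by apply: connect1; rewrite /within /= xz lxz eqxx.
Qed.

Section Separation.

Variables (k : nat) (G : sgraph).
Hypotheses (k_gt0 : 0 < k) (Gcrit : contraction_critical k G).

(** [X0] acts as a full component of [S]: it is connected and sees every vertex of [S]. *)
Definition attached (X S : {set G}) := exists X0 : {set G},
  [/\ X0 \subset X, X0 != set0,
      {in X0 &, forall x y,
         connect [rel u v | [&& u -- v, u \in X0 & v \in X0]] x y} &
      forall s, s \in S -> exists2 x, x \in X0 & s -- x].

Variables (X Y A : {set G}).
Hypothesis XY : [disjoint X & Y].
Hypothesis XY_edge : forall x y, x -- y -> x \in X -> y \notin Y.
Let S := ~: (X :|: Y).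
Hypotheses (AS : A \subset S) (A_indep : independent A) (A_neq0 : A != set0).
Let T := S :\: A.

Definition solo_coloring (f : G -> 'I_(k - 1)) c :=
  [/\ {in ~: Y &, forall x y, x -- y -> f x != f y},
      {in A, forall x, f x = c} & {in T, forall x, f x != c}].

(** The set [Y0 :|: A] is contracted and [c] is its colour; each vertex of [T] has a neighbour in
    [Y0] and so avoids [c]. Independence of [A] keeps the pulled-back colouring proper. *)
Lemma solo_coloring_exists : attached Y S -> exists f c, solo_coloring f c.
Proof.
case=> Y0 [Y0Y Y0_neq0 Y0_conn S_nbr]; have [y0 y0Y] := set0Pn _ Y0_neq0.
have [a aA] := set0Pn _ A_neq0.
pose l v := if v \in Y0 :|: A then None else Some v.
have notY0 v : v \notin Y -> v \notin Y0 by apply: contra; apply: (subsetP Y0Y).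
have l_none v : (l v == None) = (v \in Y0 :|: A) by rewrite /l; case: ifP.
have conn0 v : v \in Y0 :|: A -> connect (within (@sedge G) l None) y0 v.
  have Y0c u : u \in Y0 -> connect (within (@sedge G) l None) y0 u.
    move=> uY; apply: (connect_sub _ (Y0_conn _ _ y0Y uY)) => x y /and3P[xy xY yY].
    by apply: connect1; rewrite /within /= xy !l_none !inE xY yY.
  case/setUP=> [/Y0c//|vA]; have [u uY vu] := S_nbr _ (subsetP AS _ vA).
  apply: connect_trans (Y0c _ uY) (connect1 _).
  by rewrite /within /= sedge_sym vu !l_none !inE uY vA orbT.
have conn : class_connected l.
  move=> x y; case: (boolP (x \in Y0 :|: A)) => [xY0|xY0]; last first.
    have -> : l x = Some x by rewrite /l (negbTE xY0).
    by rewrite /l; case: ifP => // _ [->]; apply: connect0.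
  have lx : l x = None by apply/eqP; rewrite l_none.
  rewrite lx => /esym/eqP; rewrite l_none => yY0.
  apply: connect_trans (conn0 _ yY0).
  rewrite sym_connect_sym ?conn0 // => u v.
  by rewrite /within /= sedge_sym (andbC (l u == _)).
have [|f [f_eq f_edge]] := quotient_coloring Gcrit conn.
  exists a, y0; split; last first.
    by transitivity (@None G); [|symmetry]; apply/eqP; rewrite l_none !inE ?aA ?y0Y ?orbT.
  move=> ay; move: (subsetP AS _ aA).
  by rewrite ay !inE (subsetP Y0Y) // orbT.
have l_id v : v \notin Y -> v \notin A -> l v = Some v.
  by move=> vY vA; rewrite /l !inE (negbTE (notY0 _ vY)) (negbTE vA).
have l_A v : v \in A -> l v = l y0.
  by move=> vA; transitivity (@None G); [|symmetry]; apply/eqP; rewrite l_none !inE ?vA ?y0Y ?orbT.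
exists f, (f y0); split.
- move=> x y; rewrite !inE => xY yY xy; apply/eqP; apply: f_edge => //.
  case: (boolP (x \in A)) (boolP (y \in A)) => [xA|xA] [yA|yA].
  + by have /forall_inP/(_ _ xA)/forall_inP/(_ _ yA) := A_indep; rewrite xy.
  + have /eqP := l_A _ xA; rewrite (l_id y) // => /eqP->; apply/eqP.
    by rewrite eq_sym /l inE y0Y.
  + by rewrite (l_A _ yA) (l_id x) // /l inE y0Y.
  + by rewrite !l_id // => -[xyE]; rewrite xyE sedge_irr in xy.
- by move=> x /l_A/f_eq.
- move=> x /setDP[xS xA]; have [u uY xu] := S_nbr _ xS.
  have -> : f y0 = f u by apply: f_eq; rewrite /l !inE y0Y uY.
  apply/eqP/f_edge => //; rewrite l_id //; first by rewrite /l inE uY.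
  by move: xS; rewrite !inE negb_or => /andP[].
Qed.

Definition kempe (f : G -> 'I_(k - 1)) c c' : rel G :=
  [rel x y | [&& x -- y, x \notin Y, y \notin Y,
                 (f x == c) || (f x == c') & (f y == c) || (f y == c')]].

Definition locked (f : G -> 'I_(k - 1)) (c : 'I_(k - 1)) :=
  [forall c', forall x in T, forall y in T,
     [&& c' \notin f @: T, c' != c & f x == f y] ==> connect (kempe f (f x) c') x y].

Let T_notY x : x \in T -> x \notin Y.
Proof. by case/setDP; rewrite !inE negb_or => /andP[]. Qed.

(** Induction on the number of colours missing from a rainbow [T]: if two vertices of one class lie
    in different chains, swapping the chain of one of them increases the number of colours on
    [T]. *)
Lemma locked_exists f c : solo_coloring f c -> exists f', solo_coloring f' c /\ locked f' c.
Proof.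
have [n] := ubnP (#|T| - #|f @: T|); elim: n => // n IHn in f *.
rewrite ltnS => f_n f_solo; case: (boolP (locked f c)) => [|unlocked]; first by exists f.
have [f_proper f_A f_T] := f_solo.
move: unlocked; rewrite negb_forall => /existsP[c' /forall_inPn[x xT /forall_inPn[y yT]]].
rewrite negb_imply => /andP[/and3P[c'T c'c /eqP fxy] xy].
set e := kempe f (f x) c' in xy.
pose f' v := if connect e x v then tperm (f x) c' (f v) else f v.
have e_colors v : connect e x v -> v \notin Y /\ ((f v == f x) || (f v == c')).
  case/connect_last=> [->|[z /and5P[_ _ vY _ fv]] //].
  by rewrite eqxx T_notY.
have tpermE i : (i == f x) || (i == c') ->
    (tperm (f x) c' i == f x) || (tperm (f x) c' i == c').
  by case/orP=> /eqP->; rewrite ?tpermL ?tpermR eqxx ?orbT.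
have boundary u v : u -- v -> u \notin Y -> v \notin Y -> connect e x u ->
    ~~ connect e x v -> tperm (f x) c' (f u) != f v.
  move=> uv uY vY xu; apply: contra => /eqP fuv; have [_ fu] := e_colors _ xu.
  apply: connect_trans xu (connect1 _).
  by rewrite /e /kempe /= uv uY vY fu -fuv tpermE.
apply: (IHn f'); last split.
(* [x] gains [c'] while [y] keeps the old common colour, so no colour is lost. *)
- have lt : #|f @: T| < #|f' @: T|.
    have -> : #|f @: T|.+1 = #|c' |: f @: T| by rewrite cardsU1 c'T.
    apply/subset_leq_card/subsetP => i; rewrite !inE => /orP[/eqP->|/imsetP[z zT ->]].
      by apply/imsetP; exists x => //; rewrite /f' connect0 tpermL.
    case: (eqVneq (f z) (f x)) => [->|zx].
      by apply/imsetP; exists y => //; rewrite /f' (negbTE xy).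
    apply/imsetP; exists z => //; rewrite /f'; case: ifP => // _.
    by rewrite tpermD // eq_sym //; apply: contra c'T => /eqP<-; apply: imset_f.
  have le : #|f' @: T| <= #|T| := leq_imset_card _ _.
  by move: f_n lt le; clear; lia.
- move=> u v; rewrite !inE => uY vY uv; rewrite /f'.
  case: ifP => xu; case: ifP => xv.
  + by rewrite (inj_eq perm_inj) f_proper ?inE.
  + by apply: boundary; rewrite ?xv.
  + by rewrite eq_sym; apply: boundary; rewrite ?xu // sedge_sym.
  + by rewrite f_proper ?inE.
- move=> a aA; rewrite /f'; case: ifP => [/e_colors[_]|_]; last exact: f_A.
  by rewrite f_A // eq_sym (negbTE (f_T _ xT)) eq_sym (negbTE c'c).
- move=> z zT; rewrite /f'; case: ifP => [/e_colors[_ /tpermE]|_]; last exact: f_T.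
  by case/orP=> /eqP-> //; apply: f_T.
Qed.

(** The last root [c0] is either a vertex of [T] alone in its colour class or a dummy in [Y]. [f2]
    is pulled back from the contracted minor, and [f1] recolours the side of [X] to the pattern of
    [f2] on [S]. *)
Lemma locked_matching_colorings (f : G -> 'I_(k - 1)) c c0 :
    attached X S -> solo_coloring f c -> locked f c ->
    c0 \notin X -> c0 \notin A -> (c0 \in T -> f c0 \notin f @: (T :\ c0)) ->
    2 ^ #|f @: (T :\ c0)|.+1 + #|A| <= k ->
  exists f1 f2 : G -> 'I_(k - 1),
    [/\ {in ~: Y &, forall x y, x -- y -> f1 x != f1 y},
        {in ~: X &, forall x y, x -- y -> f2 x != f2 y} &
        {in S &, forall x y, (f1 x == f1 y) = (f2 x == f2 y)}].
Proof.
move=> X_att [f_proper f_A f_T] f_locked c0X c0A c0_alone k_ge.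
(* The [m] colours below [m] are the palette for the roots [0, ..., n]; the [#|A|] colours starting
   at [m] are for those that [f2] puts on [A]. *)
set n := #|_| in k_ge; pose m := 2 ^ n.+1 - 1.
have A_gt0 : 0 < #|A| by rewrite card_gt0.
have m_pos : 0 < 2 ^ n by rewrite expn_gt0.
have m_eq : m.+1 = 2 ^ n.+1 by rewrite /m (expnS 2 n); move: m_pos; clear; lia.
have mK : m + #|A| <= k - 1 by move: k_ge m_eq; clear; lia.
have m_lt : m < k - 1 by move: mK A_gt0; clear; lia.
have c0T : c0 \notin Y -> c0 \in T
  by move=> cY; apply/setDP; split=> //; rewrite !inE negb_or c0X.
pose cs := enum (f @: (T :\ c0)).
have cs_size : size cs = n by rewrite /cs -cardE.
pose d i := if i < n then odflt c0 [pick b in T :\ c0 | f b == nth c cs i] else c0.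
have dn : d n = c0 by rewrite /d ltnn.
have dP i : i < n -> d i \in T :\ c0 /\ f (d i) = nth c cs i.
  move=> i_lt; rewrite /d i_lt; case: pickP => [b /andP[bT /eqP] //|none].
  have /imsetP[b bT ib] : nth c cs i \in f @: (T :\ c0).
    by rewrite -mem_enum mem_nth // -/cs cs_size.
  by have := none b; rewrite bT ib eqxx.
have dT i : i <= n -> d i \notin Y -> d i \in T.
  rewrite leq_eqVlt => /orP[/eqP->|/dP[/setD1P[]] //]; rewrite dn; exact: c0T.
have d_inj i j : i <= n -> j <= n -> d i \in T -> d j \in T -> f (d i) = f (d j) -> i = j.
  have lt_n i' : i' < n -> f (d i') \in f @: (T :\ c0).
    by case/dP=> h _; apply: imset_f.
  rewrite leq_eqVlt => /orP[/eqP->|i_lt].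
    rewrite leq_eqVlt => /orP[/eqP-> //|j_lt]; rewrite dn => /c0_alone h _ e.
    by move: h; rewrite e lt_n.
  rewrite leq_eqVlt => /orP[/eqP->|j_lt].
    rewrite dn => _ /c0_alone h e; by move: h; rewrite -e lt_n.
  move=> _ _; have [_ ->] := dP _ i_lt; have [_ ->] := dP _ j_lt.
  by move/eqP; rewrite nth_uniq ?cs_size ?enum_uniq // => /eqP.
(* Colours are renamed so that root [i] gets [root_color n i] and [A], at index [n.+1], gets [m]. A
   dummy root is filtered out of [idx]. *)
pose tgt i : 'I_(k - 1) := insubd c (if i <= n then root_color n i else m).
have tgtE i : tgt i = (if i <= n then root_color n i else m) :> nat.
  rewrite /tgt val_insubd ifT //; case: ifP => [/root_color_lt|_] //.
  by move=> h; apply: ltn_trans h m_lt.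
pose src i := if i <= n then f (d i) else c.
pose idx := [seq i <- iota 0 n.+2 | (i <= n) ==> (d i \in T)].
have [|s sP] := @match_colors _ _ idx src tgt.
  have idxP i : i \in idx -> i <= n /\ d i \in T \/ i = n.+1.
    rewrite mem_filter mem_iota add0n leq0n /= ltnS => /andP[/implyP h1 h2].
    case: (leqP i n) h1 => [_ /(_ isT)|h _]; first by left.
    by right; apply/eqP; rewrite eqn_leq h2.
  have src_inj : {in idx &, injective src}.
    move=> i j /idxP[[i_le iT]|->] /idxP[[j_le jT]|->]; rewrite /src ?ltnn ?i_le ?j_le //.
    - exact: d_inj.
    - by move/eqP; rewrite (negbTE (f_T _ iT)).
    - by move/esym/eqP; rewrite (negbTE (f_T _ jT)).
  have tgt_inj : {in idx &, injective tgt}.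
    move=> i j /idxP[[i_le iT]|->] /idxP[[j_le jT]|->] // /(congr1 val) /=;
      rewrite !tgtE ?ltnn ?i_le ?j_le //.
    - exact: root_color_inj.
    - by have := root_color_lt i_le; rewrite -/m => h1 h2; rewrite h2 ltnn in h1.
    - by have := root_color_lt j_le; rewrite -/m => h1 h2; rewrite -h2 ltnn in h1.
  by move=> i j ii jj; rewrite (inj_in_eq src_inj) // (inj_in_eq tgt_inj).
pose phi1 v : nat := s (f v).
have phi1_d i : i <= n -> d i \in T -> phi1 (d i) = root_color n i.
  move=> i_le iT; have := sP i; rewrite /src i_le /phi1 => ->; last first.
    by rewrite mem_filter iT implybT mem_iota /= add0n ltnS leqW.
  by rewrite tgtE i_le.
have phi1_A a : a \in A -> phi1 a = m.
  move=> aA; have := sP n.+1; rewrite /src ltnn /phi1 f_A // => ->.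
    by rewrite tgtE ltnn.
  by rewrite mem_filter ltnn mem_iota /= add0n.
have T_d b : b \in T -> b != c0 -> exists2 i, i < n & f b = f (d i).
  move=> bT bc; have bcs : f b \in cs.
    by rewrite mem_enum; apply: imset_f; apply/setD1P.
  have i_lt : index (f b) cs < n by rewrite -cs_size index_mem.
  by exists (index (f b) cs) => //; have [_ ->] := dP _ i_lt; rewrite nth_index.
pose low v := (v \notin Y) && (phi1 v < m).
pose e : rel G := [rel x y | [&& x -- y, low x & low y]].
(* [phi] departs from [phi1] only at vertices isolated in [e]: a dummy root takes the last root
   colour, and the others take 0. *)
pose phi v := if v == c0 then root_color n n else if low v then phi1 v else 0.
have phi_low v : low v -> phi v = phi1 v.
  move=> v_low; rewrite /phi v_low; case: eqP => // vc; rewrite vc in v_low *.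
  have cT : c0 \in T by apply: c0T; case/andP: v_low.
  by rewrite -dn phi1_d ?dn.
have phi_d i : i <= n -> phi (d i) = root_color n i.
  rewrite leq_eqVlt => /orP[/eqP->|i_lt]; first by rewrite dn /phi eqxx.
  have [/setD1P[dc iT] _] := dP _ i_lt; have i_le := ltnW i_lt.
  rewrite phi_low ?phi1_d // /low T_notY // phi1_d //; exact: root_color_lt.
have e_sym : symmetric e by move=> x y; rewrite /e /= sedge_sym (andbC (low x)).
have [lab [lab_d lab_conn lab_class lab_lift]] :
    exists lab, rooted_pieces n e phi d lab.
  apply: rooted_pieces_exist => // [x y /and3P[xy xl yl]|x].
    rewrite !phi_low //; case/andP: xl => xY _; case/andP: yl => yY _.
    by rewrite (inj_eq val_inj) (inj_eq perm_inj) f_proper ?inE.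
  rewrite -/m /phi; case: eqP => _; first exact: root_color_lt.
  case: ifP => [/andP[] //|_]; move: m_eq m_pos; rewrite (expnS 2 n); clear; lia.
have piece_low v : v \notin Y -> lab v <= n -> low v.
  move=> vY v_le; have [vd|[z /and3P[/and3P[] //]]] := connect_last (lab_conn _ v_le).
  have vT : d (lab v) \in T by apply: dT => //; rewrite -vd.
  rewrite /low vY vd phi1_d //; exact: root_color_lt.
have piece_d v : v \notin Y -> lab v <= n -> d (lab v) \in T.
  move=> vY v_le; apply: dT => //.
  by have [-> //|[z /and3P[/and3P[_ /andP[]]]]] := connect_first (lab_conn _ v_le).
have A_lab a : a \in A -> n < lab a.
  move=> aA; rewrite ltnNge; apply/negP => a_le; have aY : a \notin Y.
    by move: (subsetP AS _ aA); rewrite !inE negb_or => /andP[].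
  by have := piece_low _ aY a_le; rewrite /low phi1_A // ltnn andbF.
have T_piece b : b \in T -> exists i, [/\ i <= n, phi b = phi (d i) &
    connect (pair_rel e phi) (d i) b].
  move=> bT; case: (eqVneq b c0) => [->|bc].
    by exists n; rewrite dn leqnn connect0.
  have [i i_lt fbd] := T_d _ bT bc; have i_le := ltnW i_lt; exists i.
  have [/setD1P[_ iT] _] := dP _ i_lt.
  have b_low : low b.
    by rewrite /low T_notY // /phi1 fbd -/(phi1 (d i)) phi1_d // root_color_lt.
  split=> //; first by rewrite phi_d // phi_low // -phi1_d // /phi1 fbd.
  have rc_lt : (root_color n i).+1 < m.
    have := root_color_lt i_le; rewrite -/m => h1.
    have h2 : root_color n i <> root_color n n.
      by move/root_color_inj => /(_ i_le (leqnn _)) in_eq; rewrite in_eq ltnn in i_lt.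
    have h3 := root_color_odd i_le; have h4 : odd (2 ^ n.+1) = false by rewrite oddX.
    move: h1 h2; rewrite root_color_last => h1 h2.
    have {h2} : root_color n i <> m.-1.
      by move: h2 m_eq m_pos; rewrite (expnS 2 n); clear; lia.
    move: h1; clear; lia.
  have c'_lt : (root_color n i).+1 < k - 1 := ltn_trans rc_lt m_lt.
  pose c' := (s^-1)%g (Ordinal c'_lt).
  have sc' : s c' = (root_color n i).+1 :> nat by rewrite /c' permKV.
  have half_lt x : (f x == f (d i)) || (f x == c') ->
      phi1 x < m /\ (phi1 x)./2 = (root_color n i)./2.
    case/orP=> /eqP fx; rewrite /phi1 fx.
      by rewrite -/(phi1 (d i)) phi1_d // root_color_lt.
    by rewrite sc' /= uphalf_half root_color_odd.
  have : connect (kempe f (f (d i)) c') (d i) b.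
    move/forallP/(_ c')/forall_inP/(_ _ iT)/forall_inP/(_ _ bT)/implyP: f_locked.
    apply; rewrite fbd eqxx andbT; apply/andP; split.
      apply/imsetP => -[x xT c'x]; move: sc'; rewrite c'x -/(phi1 x).
      have [j j_le ->] : exists2 j, j <= n & phi1 x = root_color n j.
        case: (eqVneq x c0) => [xc|xc].
          by exists n => //; rewrite xc -dn phi1_d // dn -xc.
        have [j j_lt fx] := T_d _ xT xc; exists j; first exact: ltnW.
        have [/setD1P[_ jT] _] := dP _ j_lt.
        by rewrite /phi1 fx -/(phi1 (d j)) phi1_d // ltnW.
      move/(congr1 odd); rewrite /= !root_color_odd //.
    have [a aA] := set0Pn _ A_neq0.
    apply: contraTneq rc_lt => c'c; move: sc'; rewrite c'c -(f_A _ aA) -/(phi1 a).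
    by rewrite phi1_A // => <-; rewrite ltnn.
  apply: connect_sub => x y /and5P[xy xY yY /half_lt[xm xh] /half_lt[ym yh]].
  have xl : low x by rewrite /low xY.
  have yl : low y by rewrite /low yY.
  by apply: connect1; rewrite /pair_rel /e /= xy xl yl !phi_low // xh yh eqxx.
(* The rest of the side falls into components, whose colour [m] (that of [A]) may be
   exchanged with the colour of a root unless they are adjacent to its piece. *)
pose q : rel G := [rel x y | [&& x -- y, x \notin Y, y \notin Y, n < lab x & n < lab y]].
have q_sym : connect_sym q.
  by apply: sym_connect_sym => x y; apply/and5P/and5P => -[xy *]; split; rewrite // sedge_sym.
(* Vertices of [Y] stay uncontracted. Their [inr] labels do not clash with those of the components,
   whose roots lie outside [Y]. *)
pose l : G -> nat + G := fun v => if v \in Y then inr v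
                      else if lab v <= n then inl (lab v) else inr (root q v).
have l_piece v : v \notin Y -> lab v <= n -> l v = inl (lab v).
  by move=> vY v_le; rewrite /l (negbTE vY) v_le.
have l_other v : v \notin Y -> n < lab v -> l v = inr (root q v).
  by move=> vY v_gt; rewrite /l (negbTE vY) leqNgt v_gt.
have root_notY v : v \notin Y -> root q v \notin Y.
  by move=> vY; have [->|[z /and5P[]]] := connect_last (connect_root q v).
have l_conn : class_connected l.
  have sym_l c' : connect_sym (within (@sedge G) l c').
    by apply: sym_connect_sym => u v; rewrite /within /= sedge_sym (andbC (l u == _)).
  have from_d v : v \notin Y -> lab v <= n ->
      connect (within (@sedge G) l (l v)) (d (lab v)) v.
    move=> vY v_le; have dY := T_notY (piece_d v vY v_le).
    have -> : l v = l (d (lab v)) by rewrite !l_piece // lab_d.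
    apply: connect_within (lab_conn v v_le) => x y.
    case/and3P=> /and3P[xy /andP[xY _] /andP[yY _]] /eqP lx /eqP ly.
    by rewrite !l_piece // ?lx ?ly.
  move=> x y lxy; case: (boolP (x \in Y)) (boolP (y \in Y)) => [xY|xY] [yY|yY].
  - by move: lxy; rewrite /l xY yY => -[->]; apply: connect0.
  - move: lxy; rewrite /l xY (negbTE yY); case: ifP => // _ [xr].
    by have := root_notY _ yY; rewrite -xr xY.
  - move: lxy; rewrite /l yY (negbTE xY); case: ifP => // _ [xr].
    by have := root_notY _ xY; rewrite xr yY.
  case: (leqP (lab x) n) (leqP (lab y) n) => x_le [] y_le.
  - have : lab x = lab y by move: lxy; rewrite !l_piece // => -[].
    move=> lab_xy; apply: connect_trans (_ : connect _ _ (d (lab x))) _.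
      by rewrite sym_l from_d.
    by rewrite lxy lab_xy from_d.
  - by move: lxy; rewrite l_piece // l_other.
  - by move: lxy; rewrite l_other // l_piece.
  have xy : connect q x y.
    by apply/(rootP q_sym); move: lxy; rewrite !l_other // => -[].
  apply: connect_within xy => u v uv; case/and5P: (uv) => euv uY vY u_gt v_gt.
  by rewrite !l_other //; split=> //; congr inr; apply/(rootP q_sym)/connect1.
have [a aA] := set0Pn _ A_neq0.
have aS := subsetP AS _ aA.
have SY x : x \in S -> x \notin Y by rewrite !inE negb_or => /andP[].
have XnY x : x \in X -> x \notin Y by move=> xX; rewrite (disjointFr XY).
(* The contraction is not trivial: a neighbour of [a] in [X] shares its label with a root in [T] if
   it lies in a piece, and with [a] otherwise. *)
have [|f2 [f2_eq f2_edge]] := quotient_coloring Gcrit l_conn.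
  case: X_att => X0 [X0X _ _ /(_ _ aS)[x /(subsetP X0X) xX ax]].
  have xS y : y \in S -> x <> y by rewrite !inE => h xy; rewrite -xy xX in h.
  case: (leqP (lab x) n) => x_lab.
    have dxT := piece_d _ (XnY _ xX) x_lab; exists x, (d (lab x)); split.
      by apply: xS; case/setDP: dxT.
    by rewrite (l_piece _ (XnY _ xX) x_lab) (l_piece _ (T_notY dxT)) lab_d.
  exists x, a; split; first exact: xS.
  rewrite (l_other _ (XnY _ xX) x_lab) (l_other _ (SY _ aS) (A_lab _ aA)).
  congr inr; apply/(rootP q_sym).
  by rewrite q_sym; apply: connect1; rewrite /q /= ax SY // XnY // A_lab // x_lab.
have f2_piece v : v \notin Y -> lab v <= n -> f2 v = f2 (d (lab v)).
  move=> vY v_le; apply: f2_eq.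
  by rewrite !l_piece ?lab_d // T_notY // piece_d.
pose psi i : nat := f2 (d i).
have [|phi' [phi'_proper phi'_lt phi'_eq phi'_neq phi'_class]] := lab_lift psi.
  move=> x y /and3P[xy /andP[xY _] /andP[yY _]] x_le y_le xy_lab.
  rewrite /psi -!f2_piece // => /val_inj; apply: f2_edge => //.
  by rewrite !l_piece // => -[] /eqP; rewrite (negbTE xy_lab).
(* [tau c] is the new colour of the vertices of [S] that [f2] colours with [c]. *)
pose tau c' : nat := if [pick i : 'I_n.+1 | f2 (d i) == c'] is Some i
  then phi' (d i) else m + index c' (enum (f2 @: A)).
have tauP c' : (exists2 i, i <= n & f2 (d i) = c' /\ tau c' = phi' (d i)) \/
    ((forall i, i <= n -> f2 (d i) <> c') /\ tau c' = m + index c' (enum (f2 @: A))).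
  rewrite /tau; case: pickP => [i /eqP fi|none]; last first.
    right; split=> // i i_le /eqP; have := none (Ordinal (i_le : i < n.+1)).
    by rewrite /= => ->.
  by left; exists (i : nat); first by rewrite -ltnS.
have tau_d i : i <= n -> tau (f2 (d i)) = phi' (d i).
  move=> i_le; case: (tauP (f2 (d i))) => [[j j_le [fj ->]]|[/(_ _ i_le)] //].
  by apply: phi'_eq => //; rewrite /psi fj.
have tau_lt c' : c' \in f2 @: A -> tau c' < k - 1.
  move=> c'A; case: (tauP c') => [[i i_le [_ ->]]|[_ ->]].
    exact: ltn_trans (phi'_lt _) m_lt.
  apply: leq_trans mK; rewrite ltn_add2l; apply: leq_trans (leq_imset_card f2 A).
  by rewrite cardE index_mem mem_enum.
pose base v := if low v then phi' v else phi1 v.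
(* [f2] is constant on each remaining component, so [m] and [tau] are swapped on whole components;
   membership in [f2 @: A] makes [tau] a valid colour. *)
pose g v := if (lab v <= n) || (f2 v \notin f2 @: A) then base v
            else transpose m (tau (f2 v)) (base v).
have base_lt v : base v < k - 1.
  by rewrite /base; case: ifP => _; [apply: (ltn_trans (phi'_lt _) m_lt) | apply: ltn_ord].
have g_lt v : g v < k - 1.
  rewrite /g; case: ifP => // /norP[_]; rewrite negbK => /tau_lt.
  by rewrite /transpose => h; do ![case: ifP => _ //].
have base_proper x y : x \notin Y -> y \notin Y -> x -- y -> base x != base y.
  move=> xY yY xy; rewrite /base /low xY yY /=.
  case: (ltnP (phi1 x) m) => xm; case: (ltnP (phi1 y) m) => ym.
  - by apply: phi'_proper; rewrite /e /= /low xy xY yY xm ym.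
  - by rewrite ltn_eqF // (leq_trans (phi'_lt x)).
  - by rewrite gtn_eqF // (leq_trans (phi'_lt y)).
  - by rewrite (inj_eq val_inj) (inj_eq perm_inj) f_proper ?inE.
(* Only a colour [m] turned into the colour of a root [d j] could clash. Then [f2 (d j) = f2 y]
   differs from [f2 x], and [phi'_neq] separates [x] from [d j]. *)
have mixed x y : x \notin Y -> y \notin Y -> x -- y -> lab x <= n -> n < lab y ->
    g x != g y.
  move=> xY yY xy x_le y_gt; rewrite {1}/g x_le /g leqNgt y_gt /=.
  have xy_base := base_proper _ _ xY yY xy.
  case: ifP => // _; rewrite /transpose.
  have bx : base x = phi' x by rewrite /base piece_low.
  have fxy : f2 x <> f2 y by apply: f2_edge; rewrite // l_piece // l_other.
  case: (base y =P m) => [_|_]; last first.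
    case: (base y =P tau (f2 y)) => [_|//]; rewrite bx ltn_eqF //; exact: phi'_lt.
  rewrite bx; case: (tauP (f2 y)) => [[j j_le [fj ->]]|[_ ->]].
    apply: phi'_neq => //; rewrite /psi -f2_piece // fj.
    by move/val_inj.
  by rewrite ltn_eqF // (leq_trans (phi'_lt x)) // leq_addr.
have S_g x : x \in S -> g x = tau (f2 x).
  move=> xS; case: (boolP (x \in A)) => [xA|xA].
    rewrite /g leqNgt A_lab // imset_f //= /base /low phi1_A // ltnn andbF.
    by rewrite /transpose eqxx.
  have xT : x \in T by apply/setDP.
  have [i [i_le phx cx]] := T_piece _ xT.
  have lx := lab_class _ _ i_le phx cx.
  have xY := SY _ xS; rewrite /g lx i_le /= /base piece_low ?lx //.
  have -> : f2 x = f2 (d i) by rewrite f2_piece ?lx.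
  by rewrite tau_d // (phi'_class i).
(* Root colours stay below [m] and are separated by [phi'_neq]; the other colours of [S] occur on
   [A] and have distinct indices. *)
have tau_inj : {in f2 @: S &, injective tau}.
  have index_case c' : c' \in f2 @: S -> (forall i, i <= n -> f2 (d i) <> c') ->
      c' \in enum (f2 @: A).
    case/imsetP=> x xS -> none; rewrite mem_enum; apply: imset_f.
    apply: contraT => xA; have xT : x \in T by apply/setDP.
    have [i [i_le phx cx]] := T_piece _ xT.
    have lx := lab_class _ _ i_le phx cx.
    by case: (none i i_le); rewrite [RHS]f2_piece ?lx // SY.
  have root_lt c' i : tau c' = phi' (d i) -> tau c' < m by move=> ->; apply: phi'_lt.
  move=> c1 c2 c1S c2S;
  case: (tauP c1) (tauP c2) => [[i i_le [<- ti]]|[ni ti]]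
    [[j j_le [<- tj]]|[nj tj]].
  - rewrite ti tj => phi'_ij; apply/eqP; apply: contraT => /eqP fij.
    have := phi'_neq j (d i) j_le; rewrite lab_d // => /(_ i_le) h.
    have /h : psi i <> psi j by move/val_inj.
    by rewrite phi'_ij eqxx.
  - by move=> h; have := root_lt _ _ ti; rewrite h tj ltnNge leq_addr.
  - by move=> h; have := root_lt _ _ tj; rewrite -h ti ltnNge leq_addr.
  - rewrite ti tj => /addnI h.
    by rewrite -(nth_index c1 (index_case _ c1S ni)) h nth_index // index_case.
exists (fun v => Ordinal (g_lt v)), f2; split.
- move=> x y; rewrite !inE -val_eqE /= => xY yY xy.
  case: (leqP (lab x) n) (leqP (lab y) n) => x_le [] y_le.
  + by rewrite /g x_le y_le base_proper.
  + exact: mixed.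
  + by rewrite eq_sym; apply: mixed; rewrite // sedge_sym.
  have fxy : f2 x = f2 y.
    apply: f2_eq; rewrite !l_other //; congr inr; apply/(rootP q_sym)/connect1.
    by rewrite /q /= xy xY yY x_le.
  rewrite /g (leqNgt (lab x)) (leqNgt (lab y)) x_le y_le fxy /=.
  case: ifP => _; first exact: base_proper.
  by rewrite (inj_eq (@transpose_inj _ _)) base_proper.
- move=> x y xX yX xy; apply/eqP; apply: f2_edge => // lxy; rewrite !inE in xX yX.
  have [xY|xY] := boolP (x \in Y); have [yY|yY] := boolP (y \in Y).
  + by move: lxy; rewrite /l xY yY => -[xy_eq]; rewrite xy_eq sedge_irr in xy.
  + move: lxy; rewrite /l xY (negbTE yY); case: ifP => // _ [xr].
    by have := root_notY _ yY; rewrite -xr xY.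
  + move: lxy; rewrite /l yY (negbTE xY); case: ifP => // _ [xr].
    by have := root_notY _ xY; rewrite xr yY.
  have xS : x \in S by rewrite !inE negb_or xX.
  have yS : y \in S by rewrite !inE negb_or yX.
  (* Vertices of [T] in one piece have the same [f]-colour, so they are not adjacent and contracting
     the piece loses no edge of [G[S]]. *)
  have T_lab b : b \in S -> b \notin A -> exists2 i, i <= n & lab b = i /\ phi1 b = root_color n i.
    move=> bS bA; have bT : b \in T by apply/setDP.
    have [i [i_le phb cb]] := T_piece _ bT; have lb := lab_class _ _ i_le phb cb.
    by exists i => //; split=> //; rewrite -phi_d // -phb phi_low // piece_low ?SY ?lb.
  case: (boolP (x \in A)) (boolP (y \in A)) => [xA|xA] [yA|yA].
  + by have /forall_inP/(_ _ xA)/forall_inP/(_ _ yA) := A_indep; rewrite xy.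
  + have [j j_le [ly _]] := T_lab _ yS yA.
    by move: lxy; rewrite l_other ?A_lab // l_piece // ly.
  + have [i i_le [lx _]] := T_lab _ xS xA.
    by move: lxy; rewrite l_piece ?lx // l_other ?A_lab.
  have [i i_le [lx phx]] := T_lab _ xS xA; have [j j_le [ly phy]] := T_lab _ yS yA.
  move: lxy; rewrite !l_piece ?lx ?ly // => -[ij].
  have := f_proper x y; rewrite !inE => /(_ xY yY xy).
  have /val_inj/perm_inj-> : phi1 x = phi1 y by rewrite phx phy ij.
  by rewrite eqxx.
- by move=> x y xS yS; rewrite -val_eqE /= !S_g // (inj_in_eq tau_inj) // imset_f.
Qed.

(** A locked colouring that is not rainbow on [T] would give matching colourings of the two sides.
    For [#|T| = 2] the two vertices are adjacent, hence coloured differently. *)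
Lemma rainbow_exists : attached X S -> attached Y S ->
    (#|T| = 2 -> ~~ independent T) ->
    (2 < #|T| -> 2 ^ #|T|.-1 + #|A| <= k) ->
  exists f c, solo_coloring f c /\ {in T &, injective f}.
Proof.
move=> X_att Y_att T2 T_k.
have [f0 [c /locked_exists[f [f_solo f_locked]]]] := solo_coloring_exists Y_att.
exists f, c; split=> //; apply/imset_injP; apply: contraT => f_ninj.
have f_lt : #|f @: T| < #|T| by rewrite ltn_neqAle f_ninj leq_imset_card.
have [f_proper _ _] := f_solo.
have [a aT [b bT [ab fab]]] : exists2 a, a \in T & exists2 b, b \in T & a != b /\ f a = f b.
  suff: ~~ [forall a in T, forall b in T, (a == b) || (f a != f b)].
    case/forall_inPn=> a aT /forall_inPn[b bT].
    by rewrite negb_or negbK => /andP[ab /eqP fab]; exists a => //; exists b.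
  apply: contra f_ninj => /forall_inP h; apply/imset_injP => a b aT bT fab.
  by have /forall_inP/(_ b bT) := h a aT; rewrite fab eqxx orbF => /eqP.
have T_gt2 : 2 < #|T|.
  rewrite ltnNge; apply/negP; rewrite leq_eqVlt => /orP[/eqP T_eq2|T_lt2].
    have /forall_inPn[x xT /forall_inPn[y yT]] := T2 T_eq2; rewrite negbK => xy.
    move: f_lt; rewrite T_eq2 ltnNge; case/negP.
    have <- : #|[set f x; f y]| = 2.
      by rewrite cards2 f_proper // inE T_notY.
    by apply/subset_leq_card/subsetP => i; rewrite !inE => /orP[]/eqP->; apply: imset_f.
  move: f_lt; rewrite ltnNge (leq_trans (T_lt2 : #|T| <= 1)) //.
  by rewrite card_gt0; apply/set0Pn; exists (f a); apply: imset_f.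
have shared c0 : c0 \notin X -> c0 \notin A ->
    (c0 \in T -> f c0 \notin f @: (T :\ c0)) -> #|f @: (T :\ c0)|.+2 <= #|T| -> False.
  move=> c0X c0A c0_alone n_le.
  have [|f1 [f2 [p1 p2 p12]]] :=
    locked_matching_colorings X_att f_solo f_locked c0X c0A c0_alone.
    apply: leq_trans (T_k T_gt2); rewrite leq_add2r leq_pexp2l //.
    by rewrite -ltnS prednK // (leq_ltn_trans _ T_gt2).
  apply: (no_matching_colorings Gcrit k_gt0 _ _ p1 p2).
  - move=> x; rewrite !inE -negb_and; apply/negP => /andP[xY xX].
    by rewrite (disjointFr XY xX) in xY.
  - move=> x y xy; rewrite !inE -!negb_or -negb_and; apply/negP => /andP[].
    have yx : y -- x by rewrite sedge_sym.
    case/orP=> uY /orP[] vX.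
    + by rewrite (disjointFr XY vX) in uY.
    + by have := XY_edge yx vX; rewrite uY.
    + by have := XY_edge xy vX; rewrite uY.
    + by rewrite (disjointFr XY vX) in uY.
  - by move=> x y; rewrite -setCU setUC; apply: p12.
(* With [#|T| - 1] classes some class is a singleton and serves as the last root;
   with fewer classes there is room for an isolated dummy root taken in [Y]. *)
have [T_le|T_gt] := leqP #|f @: T|.+2 #|T|.
  case: Y_att => Y0 [Y0Y /set0Pn[y /(subsetP Y0Y) yY] _ _].
  have yT : y \notin T by apply/negP => /T_notY; rewrite yY.
  have yX : y \notin X by rewrite (disjointFl XY).
  have yA : y \notin A by apply/negP => /(subsetP AS); rewrite !inE yY orbT.
  case: (shared y yX yA); first by rewrite (negbTE yT).
  by apply: leq_trans T_le; rewrite !ltnS subset_leq_card // imsetS // subD1set.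
have /card_gt0P[c0] : 0 < #|T :\ a :\ b|.
  have bTa : b \in T :\ a by apply/setD1P; rewrite eq_sym.
  have := cardsD1 b (T :\ a); have := cardsD1 a T; rewrite bTa aT.
  by move: T_gt2; clear; lia.
case/setD1P=> c0b /setD1P[c0a c0T].
(* [a] already carries the colour of [b], so the classes off [c0] are counted without [b]. *)
have without_b : #|f @: (T :\ c0)|.+2 <= #|T|.
  have sub : f @: (T :\ c0) \subset f @: (T :\ c0 :\ b).
    apply/subsetP => i /imsetP[x /setD1P[xc xT] ->].
    case: (eqVneq x b) => [->|xb]; last by apply: imset_f; apply/setD1P; split=> //; apply/setD1P.
    by rewrite -fab; apply: imset_f; apply/setD1P; split=> //; apply/setD1P; rewrite eq_sym.
  have := leq_trans (subset_leq_card sub) (leq_imset_card f (mem (T :\ c0 :\ b))).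
  have bT' : b \in T :\ c0 by apply/setD1P; rewrite eq_sym.
  have := cardsD1 b (T :\ c0); have := cardsD1 c0 T; rewrite bT' c0T.
  by rewrite -[#|mem _|]/(#|T :\ c0 :\ b|); clear; lia.
case: (shared c0) => //; first by case/setDP: c0T; rewrite !inE negb_or => /andP[].
  by case/setDP: c0T.
move=> _; apply/negP => c0_in; move: T_gt; apply/negP; rewrite -leqNgt.
apply: leq_trans without_b; rewrite !ltnS; apply/subset_leq_card/subsetP.
move=> i /imsetP[x xT ->]; case: (eqVneq x c0) => [->//|xc].
by apply: imset_f; apply/setD1P.
Qed.

End Separation.

(** * Minimal separators *)

Section Separator.

Variable G : sgraph.

Definition avoiding (S : {set G}) : rel G :=
  [rel x y | [&& x -- y, x \notin S & y \notin S]].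

Definition component (S : {set G}) x := [set y | connect (avoiding S) x y].

Definition separator (S : {set G}) :=
  [exists x, exists y, [&& x \notin S, y \notin S & y \notin component S x]].

Lemma avoiding_sym (S : {set G}) : connect_sym (avoiding S).
Proof.
apply: sym_connect_sym => x y.
by rewrite /avoiding /= sedge_sym (andbC (x \notin S)).
Qed.

Lemma component_disjoint (S : {set G}) x : x \notin S -> [disjoint component S x & S].
Proof.
move=> xS; apply/pred0P => y /=; rewrite inE; apply/negP => /andP[].
by case/connect_last=> [->|[z /and3P[_ _ /negP]]] //; apply/negP.
Qed.

(** If some [s] had no neighbour in the component, the component would stay closed after restoring
    [s], and [S :\ s] would still separate [x] from [y]. *)
Lemma component_attached (S : {set G}) x y :
    minset separator S -> x \notin S -> y \notin S -> y \notin component S x ->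
  attached (component S x) S.
Proof.
move=> /minsetP[_ S_min] xS yS yx; exists (component S x); split=> //.
- by apply/set0Pn; exists x; rewrite inE connect0.
- have key u : u \in component S x -> connect
      [rel u v | [&& u -- v, u \in component S x & v \in component S x]] x u.
    rewrite inE => /connectP[p]; elim/last_ind: p u => [|p z IHp] u /=.
      by move=> _ ->; apply: connect0.
    rewrite rcons_path last_rcons => /andP[xp pz] ->.
    have last_x : last x p \in component S x by rewrite inE; apply/connectP; exists p.
    apply: connect_trans (IHp _ xp erefl) (connect1 _); case/and3P: (pz) => e _ _.
    rewrite /= e last_x inE; rewrite inE in last_x.
    exact: connect_trans last_x (connect1 pz).
  move=> u v uC vC; apply: connect_trans (key _ vC); rewrite sym_connect_sym ?key //.
  by move=> a b /=; rewrite sedge_sym (andbC (a \in _)).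
move=> s sS; have [z /andP[zC sz]|none] := pickP (fun z => (z \in component S x) && (s -- z)).
  by exists z.
have /S_min : separator (S :\ s).
  apply/existsP; exists x; apply/existsP; exists y.
  rewrite !inE (negbTE xS) (negbTE yS) !andbF /=; apply: contra yx => xy.
  have closed u v : connect (avoiding (S :\ s)) u v -> u \in component S x -> v \in component S x.
    case/connectP=> p; elim: p u => [|z p IHp] u /=; first by move=> _ ->.
    case/andP=> /and3P[uz _ zS] zp vE uC; apply: IHp zp vE _.
    have sz : z != s.
      by apply: contraFneq (none u) => <-; rewrite uC sedge_sym uz.
    have zS' : z \notin S by rewrite !inE sz in zS.
    have uS : u \notin S by rewrite (disjointFr (component_disjoint xS) uC).
    rewrite inE in uC; rewrite inE; apply: connect_trans uC (connect1 _).
    by rewrite /avoiding /= uz uS zS'.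
  by have := closed _ _ xy; rewrite !inE connect0; apply.
by move=> /(_ (subD1set _ _)) S_eq; move: sS; rewrite -S_eq !inE eqxx.
Qed.

Lemma separator_connected (S : {set G}) :
  ~~ separator S -> 0 < #|~: S| -> connected (del_vertices S).
Proof.
move=> S_nsep S_lt; split; first by rewrite card_sig.
move=> x y; have xS : val x \notin S by have := valP x; rewrite inE.
have yS : val y \notin S by have := valP y; rewrite inE.
have xy : connect (avoiding S) (val x) (val y).
  apply: contraT => xy; case/negP: S_nsep; apply/existsP; exists (val x).
  by apply/existsP; exists (val y); rewrite xS yS inE.
have := @connect_homo _ _ _ (@sedge (del_vertices S)) (insubd x) _ _ _ xy.
rewrite !valKd; apply=> u v /and3P[uv uS vS]; apply: connect1.
by rewrite /= /induced_rel /= !insubdK ?inE.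
Qed.

End Separator.

(** Monotonicity of [2 ^ (p - 1) - p] for positive [p], free of truncated subtraction; it transfers
    the bound from [t] to [#|T| <= t]. *)
Lemma expn2_sub_mono p t : 0 < p -> p <= t -> 2 ^ p.-1 + t <= 2 ^ t.-1 + p.
Proof.
case: p => // p _; elim: t => // t IHt; rewrite leq_eqVlt ltnS => /orP[/eqP-> //|pt].
have := IHt pt; case: t pt {IHt} => // t _ /=.
have : 0 < 2 ^ t by rewrite expn_gt0.
by rewrite (expnS 2 t); lia.
Qed.

(** * The independent part of the separator, and the conclusion *)

Lemma independence_numberP (G : sgraph) :
  exists2 B : {set G}, independent B & independence_number G = #|B|.
Proof.
have [|B B_indep B_max] := @eq_bigmax_cond _ (mem (@independent G)) (fun B => #|B|).
  apply/card_gt0P; exists set0; rewrite unfold_in.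
  by apply/forall_inP => x; rewrite inE.
by exists B => //; rewrite /independence_number -B_max; apply: eq_bigl.
Qed.

Lemma independent_sub (G : sgraph) (A B : {set G}) :
  A \subset B -> independent B -> independent A.
Proof.
move=> AB /forall_inP B_indep; apply/forall_inP => x /(subsetP AB) xB.
apply/forall_inP => y /(subsetP AB); move: y; exact/forall_inP/B_indep.
Qed.
Lemma independent1 (G : sgraph) (x : G) : independent [set x].
Proof.
apply/forall_inP => y; rewrite inE => /eqP->; apply/forall_inP => z.
by rewrite inE => /eqP->; rewrite sedge_irr.
Qed.

(** A largest independent [A] in [S] is taken. If it leaves two vertices and [#|A| > 1], one vertex
    of [A] is given up, leaving three, still at most [t]; if [#|A| = 1], maximality makes the two
    remaining vertices adjacent. *)
Lemma choose_independent (G : sgraph) (S B : {set G}) t :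
    2 < t -> S != set0 -> B \subset S -> independent B -> #|S :\: B| <= t ->
  exists A : {set G}, [/\ A \subset S, independent A, A != set0, #|S :\: A| <= t &
    #|S :\: A| = 2 -> ~~ independent (S :\: A)].
Proof.
move=> t_gt2 /set0Pn[s sS] BS B_indep SB.
pose P (A : {set G}) := (A \subset S) && independent A.
have PB : P B by apply/andP.
have [A /andP[AS A_indep] A_max] := @arg_maxnP _ B P (fun A : {set G} => #|A|) PB.
have A_ge (C : {set G}) : C \subset S -> independent C -> #|C| <= #|A|.
  by move=> CS C_indep; apply: A_max; apply/andP.
have A_gt0 : 0 < #|A| by rewrite -(cards1 s) A_ge ?sub1set ?independent1.
have cardD (C : {set G}) : C \subset S -> #|S :\: C| = #|S| - #|C|.
  by move=> /setIidPr CS; rewrite cardsD CS.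
have SA : #|S :\: A| <= t.
  by apply: leq_trans SB; rewrite !cardD // leq_sub2l // A_ge.
have [A_gt1|A_le1] := ltnP 1 #|A|; last first.
  exists A; split=> //; first by rewrite -card_gt0.
  move=> SA2; apply/negP => /A_ge; rewrite subsetDl SA2 => /(_ isT).
  by rewrite leqNgt ltnS A_le1.
have [SA2|SA_neq2] := eqVneq #|S :\: A| 2; last first.
  exists A; split=> //; first by rewrite -card_gt0.
  by move=> SA2; rewrite SA2 in SA_neq2.
have [x xA] : exists x, x \in A by apply/card_gt0P.
have AxS : A :\ x \subset S := subset_trans (subD1set _ _) AS.
have Ax := cardsD1 x A; rewrite xA in Ax.
have card3 : #|S :\: (A :\ x)| = 3.
  have := subset_leq_card AS; rewrite cardD // in SA2; rewrite cardD //.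
  by move: Ax SA2 A_gt1; clear; lia.
exists (A :\ x); split; rewrite ?card3 //.
- exact: independent_sub (subD1set _ _) A_indep.
- by rewrite -card_gt0; move: Ax A_gt1; clear; lia.
Qed.

Lemma no_minimal_separator (k t : nat) (G : sgraph) (S B : {set G}) :
    0 < k -> 2 < t -> contraction_critical k G -> #|S| + 2 ^ (t - 1) <= k + t ->
    B \subset S -> independent B -> #|S :\: B| <= t ->
  ~ minset (@separator G) S.
Proof.
move=> k_gt0 t_gt2 Gcrit k_ge BS B_indep SB S_min.
have [/existsP[x /existsP[y /and3P[xS yS yx]]] _] := minsetP S_min.
have xy : x \notin component S y by rewrite inE avoiding_sym; rewrite inE in yx.
pose X := component S x; pose Y := ~: (S :|: X).
have XS : [disjoint X & S] := component_disjoint xS.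
have XY : [disjoint X & Y] by rewrite disjoints_subset setCK subsetUr.
have SE : ~: (X :|: Y) = S.
  apply/setP => z; rewrite !inE negb_or negbK orbC.
  case: (boolP (z \in S)) => zS /=; last by case: connect.
  by have := disjointFl XS zS; rewrite inE => ->.
have XY_edge u v : u -- v -> u \in X -> v \notin Y.
  move=> uv uX; rewrite !inE negbK; case: (boolP (v \in S)) => //= vS.
  have uS := disjointFr XS uX; rewrite inE in uX.
  by apply: connect_trans uX (connect1 _); rewrite /avoiding /= uv vS uS.
have X_att : attached X S by apply: component_attached S_min xS yS yx.
have Y_att : attached Y S.
  have [Y0 [Y0Y Y0_neq0 Y0_conn Y0_nbr]] := component_attached S_min yS xS xy.
  exists Y0; split=> //; apply: subset_trans Y0Y _; apply/subsetP => z zy.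
  rewrite !inE negb_or (disjointFr (component_disjoint yS) zy) /=.
  rewrite inE in zy; apply: contra yx; rewrite inE => xz; apply: connect_trans xz _.
  by rewrite avoiding_sym.
(* With an empty separator the two sides have no edges between them, and each is coloured as a
   proper induced subgraph. *)
have [S0|S_neq0] := eqVneq S set0.
  have notXY z : (z \in X) || (z \in Y) by rewrite !inE S0 inE orbN.
  have YX_edge u v : u -- v -> u \in Y -> v \notin X.
    by move=> uv; apply: contraL => vX; apply: XY_edge vX; rewrite sedge_sym.
  have yY : y \in Y by have := notXY y; rewrite (negbTE yx).
  have xX : x \in X by rewrite inE connect0.
  have [|f fP] := subset_coloring Gcrit xX.
    by apply/eqP => XT; move: yx; rewrite -/X XT inE.
  have [|g gP] := subset_coloring Gcrit yY.
    by apply/eqP => YT; have := disjointFr XY xX; rewrite YT inE.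
  apply: (no_matching_colorings Gcrit k_gt0 notXY _ fP gP).
    move=> u v uv; case/orP: (notXY u) => uZ; apply/orP; [left|right]; rewrite uZ.
      by have := notXY v; rewrite (negbTE (XY_edge _ _ uv uZ)) orbF.
    by have := notXY v; rewrite (negbTE (YX_edge _ _ uv uZ)).
  by move=> u v; rewrite inE => /andP[uX uY]; rewrite (disjointFr XY uX) in uY.
have [A [AS A_indep A_neq0 SA SA2]] := choose_independent t_gt2 S_neq0 BS B_indep SB.
have SA_k : 2 < #|S :\: A| -> 2 ^ #|S :\: A|.-1 + #|A| <= k.
  move=> SA_gt; have := expn2_sub_mono (ltn_trans (isT : 0 < 2) SA_gt) SA.
  have := subset_leq_card AS; have : #|S :\: A| = #|S| - #|A|.
    by rewrite cardsD (setIidPr AS).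
  by move: k_ge; rewrite subn1; clear; lia.
have YX : [disjoint Y & X] by rewrite disjoint_sym.
have YX_edge u v : u -- v -> u \in Y -> v \notin X.
  by move=> uv; apply: contraL => vX; apply: XY_edge vX; rewrite sedge_sym.
have SE' : ~: (Y :|: X) = S by rewrite setUC.
clearbody X Y; have := @rainbow_exists k G k_gt0 Gcrit X Y A XY XY_edge.
rewrite /solo_coloring SE => /(_ AS A_indep A_neq0 X_att Y_att SA2 SA_k)
  [f [c [[fP fA fT] f_inj]]].
have := @rainbow_exists k G k_gt0 Gcrit Y X A YX YX_edge.
rewrite /solo_coloring SE' => /(_ AS A_indep A_neq0 Y_att X_att SA2 SA_k)
  [g [c' [[gP gA gT] g_inj]]].
apply: (no_matching_colorings Gcrit k_gt0 _ _ fP gP).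
- by move=> z; rewrite -in_setU -setCI setIC (disjoint_setI0 XY) setC0 inE.
- move=> u v uv; rewrite !in_setC -!negb_or -negb_and; apply/negP => /andP[].
  have vu : v -- u by rewrite sedge_sym.
  case/orP=> zY /orP[] zX.
  + by rewrite (disjointFr YX zY) in zX.
  + by have := XY_edge _ _ vu zX; rewrite zY.
  + by have := XY_edge _ _ uv zX; rewrite zY.
  + by rewrite (disjointFr YX zY) in zX.
have SI : ~: Y :&: ~: X = S by rewrite -setCU SE'.
move=> u v; rewrite SI => uS vS.
(* Rainbow colourings of either side show the same pattern on [S]: one colour for [A] and a private
   one for each vertex outside [A]. *)
have rainbow (h : G -> 'I_(k - 1)) c0 : {in A, forall x, h x = c0} -> {in S :\: A, forall x, h x != c0} ->
    {in S :\: A &, injective h} ->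
    (h u == h v) = (u \in A) && (v \in A) || (u == v).
  move=> hA hT h_inj.
  have [uA|uA] := boolP (u \in A); have [vA|vA] := boolP (v \in A).
  - by rewrite !hA ?eqxx.
  - have vT : v \in S :\: A by apply/setDP.
    by rewrite hA // eq_sym (negbTE (hT _ vT)) eq_sym; apply/esym; apply: contraNF vA => /eqP->.
  - have uT : u \in S :\: A by apply/setDP.
    by rewrite (hA v) // (negbTE (hT _ uT)); apply/esym; apply: contraNF uA => /eqP->.
  - have uT : u \in S :\: A by apply/setDP.
    have vT : v \in S :\: A by apply/setDP.
    by rewrite (inj_in_eq h_inj).
by rewrite (rainbow f c) // (rainbow g c').
Qed.

Theorem theorem1p6 (k s t : nat) (k_ge1 : 1 <= k) (t_ge3 : 3 <= t)
    (k_ge : s + 2 ^ (t - 1) <= k + t)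
    (G : sgraph) (Gcrit : contraction_critical k G)
    (S : {set G}) (S_le : #|S| <= s)
    (alpha_ge : #|S| <= independence_number (induced S) + t) :
  connected (del_vertices S).
Proof.
have pow_gt : t < 2 ^ (t - 1).
  have := @expn2_sub_mono 3 t isT t_ge3; rewrite subn1 /=; lia.
apply: separator_connected; last first.
  rewrite lt0n cards_eq0; apply/eqP => SC0.
  (* [t < 2 ^ (t - 1)] gives [s < k], so if [S] were all of [G], its vertices could receive distinct
     colours among [k - 1]. *)
  have G_le : #|G| <= k - 1.
    by rewrite -cardsT -setC0 -SC0 setCK; lia.
  apply: (crit_no_coloring Gcrit k_ge1 (f := fun x => widen_ord G_le (enum_rank x))).
  move=> x y xy; apply: contraTneq xy => /(congr1 val) /= /val_inj /enum_rank_inj ->.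
  by rewrite sedge_irr.
apply/negP => /minset_exists[S' S'_min S'S].
have [B B_indep alphaE] := independence_numberP (induced S).
have B_card : #|[set val b | b in B]| = #|B| by rewrite card_imset //; apply: val_inj.
have BS : [set val b | b in B] \subset S.
  by apply/subsetP => _ /imsetP[b _ ->]; apply: valP.
(* Shrinking [S] to [S'] may remove vertices of the independent set, but those left outside it only
   become fewer. *)
apply: (@no_minimal_separator k t G S' (S' :&: [set val b | b in B])) => //.
- by have := subset_leq_card S'S; lia.
- exact: subsetIl.
- apply: independent_sub (subsetIr _ _) _.
  apply/forall_inP => _ /imsetP[x xB ->]; apply/forall_inP => _ /imsetP[y yB ->].
  by have /forall_inP/(_ _ xB)/forall_inP/(_ _ yB) := B_indep.
- rewrite setDIr setDv set0U.
  apply: leq_trans (subset_leq_card (setSD _ S'S)) _.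
  by rewrite cardsD (setIidPr BS) B_card; move: alpha_ge; rewrite alphaE; lia.
Qed.
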